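(* There exists a universal constant $K<\infty$ such that the following holds. Let $Z_i$, $i=1,\dots,n$, be independent random variables with values in a measurable space $(T,\mathcal{T})$, and let $\mathcal{F}$ be a countable class of measurable real functions on $T$ such that $Ef^2(Z_i)<\infty$ and $Ef(Z_i)=0$ for all $i$ and all $f\in\mathcal{F}$. Set $$S:=\sup_{f\in\mathcal{F}}\sum_i f(Z_i),\qquad \sigma^2:=\sup_{f\in\mathcal{F}}\sum_i E(f(Z_i))^2,\quad \sigma\ge0.$$ Then $$E|S|^p\le K^p\Bigl[(E|S|)^{p}+p^{p/2}\sigma^{p}+p^{p}E\max_i\sup_{f\in\mathcal{F}}|f(Z_i)|^p\Bigr]$$ for all $p\ge1$. *)

(* Defs.v *)
From mathcomp Require Import all_boot all_order all_algebra.
From mathcomp Require Import all_classical all_reals all_analysis.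
Import Order.TTheory GRing.Theory Num.Theory.
Import numFieldNormedType.Exports.

Set Implicit Arguments.
Unset Strict Implicit.
Unset Printing Implicit Defensive.

Local Open Scope classical_set_scope.
Local Open Scope ring_scope.
Local Open Scope ereal_scope.

(* Mutual independence: the product rule over every subfamily. *)
Definition mutually_independent (R : realType) (d d' : measure_display)
    (Omega : measurableType d) (T : measurableType d') (P : probability Omega R)
    (n : nat) (Z : 'I_n -> {RV P >-> T}) : Prop :=
  forall (J : {set 'I_n}) (A : 'I_n -> set T),
    (forall i, i \in J -> measurable (A i)) ->
    P (\bigcap_(i in [set` J]) (Z i @^-1` A i)) =
    \prod_(i in J) P (Z i @^-1` A i).

(* All suprema and moments below live in \bar R, since nothing prevents them
   from being infinite. *)

Definition sup_sum (R : realType) (d d' : measure_display)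
    (Omega : measurableType d) (T : measurableType d') (P : probability Omega R)
    (n : nat) (Z : 'I_n -> {RV P >-> T}) (F : set {mfun T >-> R})
    (w : Omega) : \bar R :=
  ereal_sup [set (\sum_(i < n) f (Z i w))%R%:E | f in F].

Definition weak_variance (R : realType) (d d' : measure_display)
    (Omega : measurableType d) (T : measurableType d') (P : probability Omega R)
    (n : nat) (Z : 'I_n -> {RV P >-> T}) (F : set {mfun T >-> R}) : \bar R :=
  ereal_sup
    [set \sum_(i < n) 'E_P[(fun w => (f (Z i w) ^+ 2)%R)] | f in F].

(* The base value 0 of the maximum is neutral, since the terms are suprema of
   nonnegative numbers; it only matters when n = 0 or F is empty. *)
Definition max_sup_pow (R : realType) (d d' : measure_display)
    (Omega : measurableType d) (T : measurableType d') (P : probability Omega R)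
    (n : nat) (Z : 'I_n -> {RV P >-> T}) (F : set {mfun T >-> R}) (p : R)
    (w : Omega) : \bar R :=
  \big[maxe/0]_(i < n) ereal_sup [set (`|f (Z i w)| `^ p)%R%:E | f in F].

(* Main.v *)
(* The upper tail of S is bounded first.  For a uniformly bounded class, the
   subadditivity of entropy reduces E e^(sS) to bounding the sum over k of
   E (S - S_k)^2 e^(sS), where S_k resamples the k-th variable.  This difference
   is governed by the value a_k at Z_k of the maximizing function, which is not
   centered since the maximizer depends on Z_k.  However, if a_k, a_k' and a_k''
   come from three exchangeable values of the k-th variable, then each of the
   pairwise sums a_k + a_k', ... is a sum of values of a maximizer at an
   independent point and of the nonnegative losses made by keeping the maximizer
   of one sample for another.  The losses add up to at most E S e^(sS) in
   weighted mean, so the sum over k of E a_k^2 e^(sS) is at most a constant times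
   sigma^2 E e^(sS) + b E S e^(sS).  This argument is one-sided: no supremum of
   absolute values appears.  Herbst's argument then bounds E e^(sS) for a fixed s.

   Truncating at a constant level, after scaling, reduces the general class to a
   bounded one plus a sum of independent nonnegative variables with few nonzero
   terms.  The lower tail of S is that of a single sum, whose negative is again a
   supremum over a class.  All this is done for variables with finitely many
   values, where expectations are finite sums; simple functions, finite
   subclasses and Fatou's lemma give the general case. *)

Require Import Defs.
From mathcomp Require Import all_boot all_order all_algebra.
From mathcomp Require Import all_classical all_reals all_analysis.
From mathcomp Require Import measurable_realfun ring lra.
Import Order.TTheory GRing.Theory Num.Theory.
Import numFieldNormedType.Exports.

Set Implicit Arguments.
Unset Strict Implicit.
Unset Printing Implicit Defensive.

Local Open Scope ring_scope.

(** * Finite product probability spaces *)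

Section FiniteProduct.
Context {R : realType} {T : finType} {n : nat}.
Implicit Types (k : 'I_n) (w : {ffun 'I_n -> T}) (t : T).

Definition upd w k t : {ffun 'I_n -> T} := [ffun i => if i == k then t else w i].

Lemma upd_eq w k t : upd w k t k = t.
Proof. by rewrite ffunE eqxx. Qed.

Lemma upd_neq w k t i : i != k -> upd w k t i = w i.
Proof. by rewrite ffunE => /negbTE ->. Qed.

Lemma upd_upd w k s t : upd (upd w k s) k t = upd w k t.
Proof. by apply/ffunP => i; rewrite !ffunE; case: eqP. Qed.

Lemma upd_id w k : upd w k (w k) = w.
Proof. by apply/ffunP => i; rewrite !ffunE; case: eqP => // ->. Qed.

Variable mu : 'I_n -> T -> R.
Hypothesis mu_ge0 : forall i t, 0 <= mu i t.
Hypothesis mu_sum1 : forall i, \sum_t mu i t = 1.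

Definition pmass w := \prod_i mu i (w i).
Definition expect (g : {ffun 'I_n -> T} -> R) := \sum_w pmass w * g w.
(* [expect2 k] draws, besides [w], an independent copy [t] of the coordinate [w k]. *)
Definition expect2 k (g : {ffun 'I_n -> T} -> T -> R) :=
  expect (fun w => \sum_t mu k t * g w t).
Definition Avg k (g : {ffun 'I_n -> T} -> R) w := \sum_t mu k t * g (upd w k t).

Lemma pmass_ge0 w : 0 <= pmass w.
Proof. by apply: prodr_ge0 => i _. Qed.

Lemma eq_expect g h : g =1 h -> expect g = expect h.
Proof. by move=> gh; apply: eq_bigr => w _; rewrite gh. Qed.

Lemma expect_cst c : expect (fun=> c) = c.
Proof.
rewrite /expect -mulr_suml /pmass -(bigA_distr_bigA (fun i t => mu i t)) /=.
by under eq_bigr do rewrite mu_sum1; rewrite big1_eq mul1r.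
Qed.

Lemma expectD g h : expect (fun w => g w + h w) = expect g + expect h.
Proof. by rewrite /expect -big_split; apply: eq_bigr => w _; rewrite mulrDr. Qed.

Lemma expectZ c g : expect (fun w => c * g w) = c * expect g.
Proof. by rewrite /expect mulr_sumr; apply: eq_bigr => w _; rewrite mulrCA. Qed.

Lemma expectZr c g : expect (fun w => g w * c) = expect g * c.
Proof. by rewrite mulrC -expectZ; apply: eq_expect => w; rewrite mulrC. Qed.

Lemma expectN g : expect (fun w => - g w) = - expect g.
Proof. by rewrite -mulN1r -expectZ; apply: eq_expect => w; rewrite mulN1r. Qed.

Lemma expectB g h : expect (fun w => g w - h w) = expect g - expect h.
Proof. by rewrite expectD expectN. Qed.

Lemma expect_sum (I : Type) (r : seq I) (P : pred I) (g : I -> {ffun 'I_n -> T} -> R) :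
  expect (fun w => \sum_(i <- r | P i) g i w) = \sum_(i <- r | P i) expect (g i).
Proof.
by rewrite /expect exchange_big; apply: eq_bigr => w _; rewrite mulr_sumr.
Qed.

Lemma le_expect g h : (forall w, g w <= h w) -> expect g <= expect h.
Proof. by move=> gh; apply: ler_sum => w _; rewrite ler_wpM2l ?pmass_ge0. Qed.

Lemma expect_ge0 g : (forall w, 0 <= g w) -> 0 <= expect g.
Proof. by move=> g0; apply: sumr_ge0 => w _; rewrite mulr_ge0 ?pmass_ge0. Qed.

Lemma eq_expect2 k g h : (forall w t, g w t = h w t) -> expect2 k g = expect2 k h.
Proof.
by move=> gh; apply: eq_expect => w; apply: eq_bigr => t _; rewrite gh.
Qed.

Lemma le_expect2 k g h : (forall w t, g w t <= h w t) -> expect2 k g <= expect2 k h.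
Proof.
by move=> gh; apply: le_expect => w; apply: ler_sum => t _; rewrite ler_wpM2l.
Qed.

Lemma expect2D k g h : expect2 k (fun w t => g w t + h w t) = expect2 k g + expect2 k h.
Proof.
rewrite /expect2 -expectD; apply: eq_expect => w; rewrite -big_split.
by apply: eq_bigr => t _; rewrite mulrDr.
Qed.

Lemma expect2Z k c g : expect2 k (fun w t => c * g w t) = c * expect2 k g.
Proof.
rewrite /expect2 -expectZ; apply: eq_expect => w; rewrite mulr_sumr.
by apply: eq_bigr => t _; rewrite mulrCA.
Qed.

Lemma expect2N k g : expect2 k (fun w t => - g w t) = - expect2 k g.
Proof. by rewrite -mulN1r -expect2Z; apply: eq_expect2 => w t; rewrite mulN1r. Qed.

Lemma expect2_fst k g : expect2 k (fun w _ => g w) = expect g.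
Proof. by apply: eq_expect => w; rewrite -mulr_suml mu_sum1 mul1r. Qed.

(** Detailed balance between a coordinate and its independent copy; the product form avoids dividing
    by a mass that may vanish. *)
Lemma pmass_upd w k t : pmass (upd w k t) * mu k (w k) = pmass w * mu k t.
Proof.
rewrite /pmass (bigD1 k) // [in RHS](bigD1 k) //= upd_eq.
rewrite (eq_bigr (fun i => mu i (w i))) => [|i ik]; last by rewrite upd_neq.
by ring.
Qed.

(** Exchanging [w k] with its copy [t] is an involution on pairs that preserves the product mass, by
    [pmass_upd]. The symmetrizations below rest on this. *)
Lemma expect2_swap k g : expect2 k g = expect2 k (fun w t => g (upd w k t) (w k)).
Proof.
have E2 h : expect2 k h =
    \sum_(z : {ffun 'I_n -> T} * T) pmass z.1 * mu k z.2 * h z.1 z.2.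
  rewrite -(pair_big xpredT xpredT (fun w t => pmass w * mu k t * h w t)) /=.
  apply: eq_bigr => w _; rewrite mulr_sumr.
  by apply: eq_bigr => t _; rewrite mulrA.
rewrite !E2.
pose sw (z : {ffun 'I_n -> T} * T) := (upd z.1 k z.2, z.1 k).
have swK : involutive sw.
  by case=> w t; rewrite /sw /= upd_upd upd_id upd_eq.
rewrite (reindex_inj (inv_inj swK)) /=.
by apply: eq_bigr => -[w t] _ /=; rewrite pmass_upd.
Qed.

Lemma expect_Avg k g : expect (Avg k g) = expect g.
Proof.
by rewrite -[RHS](expect2_fst k) expect2_swap.
Qed.

(** The hypothesis says that [g] ignores the coordinate [k]: after the swap, [xi] sees only the copy
    [t], and [g] only [w]. *)
Lemma expect_indep k (xi : T -> R) g :
  (forall w t, g (upd w k t) = g w) ->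
  expect (fun w => xi (w k) * g w) = (\sum_t mu k t * xi t) * expect g.
Proof.
move=> gk; rewrite -(expect2_fst k) expect2_swap.
rewrite (@eq_expect2 _ _ (fun w t => xi t * g w)); last first.
  by move=> w t; rewrite upd_eq gk.
rewrite -expectZ; apply: eq_expect => w; rewrite mulr_suml.
by apply: eq_bigr => t _; rewrite mulrA.
Qed.

Lemma expect_coord k (xi : T -> R) : expect (fun w => xi (w k)) = \sum_t mu k t * xi t.
Proof.
have := @expect_indep k xi (fun=> 1) (fun _ _ => erefl).
by rewrite expect_cst mulr1 => <-; apply: eq_expect => w; rewrite mulr1.
Qed.

Lemma Avg_gt0 k g w : (forall w, 0 < g w) -> 0 < Avg k g w.
Proof.
move=> g0; rewrite /Avg lt_def; apply/andP; split; last first.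
  by apply: sumr_ge0 => t _; rewrite mulr_ge0 // ltW.
apply: contraTneq isT => /psumr_eq0P H.
have : \sum_t mu k t == 0.
  apply/eqP/big1 => t _; have /eqP := H (fun s _ => mulr_ge0 (mu_ge0 k s) (ltW (g0 _))) t isT.
  by rewrite mulf_eq0 (gt_eqF (g0 _)) orbF => /eqP.
by rewrite mu_sum1 oner_eq0.
Qed.

Lemma Avg_indep k g h w : (forall w t, h (upd w k t) = h w) ->
  Avg k (fun w => g w * h w) w = Avg k g w * h w.
Proof.
by move=> hk; rewrite /Avg mulr_suml; apply: eq_bigr => t _; rewrite hk mulrA.
Qed.

Lemma Avg_upd k g w t : Avg k g (upd w k t) = Avg k g w.
Proof. by apply: eq_bigr => s _; rewrite upd_upd. Qed.

(** * Subadditivity of entropy *)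

Lemma ln_leB1 (x y : R) : 0 < x -> 0 < y -> ln x <= ln y + x / y - 1.
Proof.
move=> x0 y0; have xy0 : 0 < x / y by rewrite divr_gt0.
have := @expR_ge1Dx R (ln (x / y)); rewrite lnK // => ?.
by rewrite -[in leLHS](divfK (lt0r_neq0 y0) x) lnM ?posrE //; lra.
Qed.

(* [u] will be the ratio of two successive partial averages of [g], so that its
   average in coordinate [k] is 1. *)
Lemma entropy_step k (g u : {ffun 'I_n -> T} -> R) :
  (forall w, 0 < g w) -> (forall w, 0 < u w) -> (forall w, Avg k u w = 1) ->
  expect (fun w => g w * ln (u w)) <=
  expect (fun w => g w * (ln (g w) - Avg k (fun w => ln (g w)) w)).
Proof.
move=> g0 u0 u1.
have A0 w : 0 < Avg k g w by exact: Avg_gt0.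
(* Jensen's inequality for [ln], from its tangent at the mean. *)
have jensen w : Avg k (fun w => ln (g w)) w <= ln (Avg k g w).
  have -> : ln (Avg k g w) =
      \sum_t mu k t * (ln (Avg k g w) + g (upd w k t) / Avg k g w - 1).
    under eq_bigr do rewrite mulrBr mulrDr mulrA mulr1.
    rewrite sumrB big_split /= -!mulr_suml mu_sum1 mul1r -/(Avg k g w) divff ?addrK //.
    exact: lt0r_neq0.
  by apply: ler_sum => t _; rewrite ler_wpM2l // ln_leB1.
(* This null mean is added to the right-hand side; the inequality then holds pointwise, by the
   tangent to [ln] at [g w], evaluated at [u w * Avg k g w]. *)
have E0 : expect (fun w => u w * Avg k g w - g w) = 0.
  rewrite expectB -(expect_Avg k) (eq_expect (h := Avg k g)) ?expect_Avg ?subrr // => w.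
  by rewrite Avg_indep ?u1 ?mul1r // => ? ?; exact: Avg_upd.
rewrite -[leRHS]addr0 -E0 -expectD; apply: le_expect => w.
have := @ln_leB1 (u w * Avg k g w) (g w).
rewrite lnM ?posrE // => /(_ (mulr_gt0 (u0 w) (A0 w)) (g0 w)) H.
have -> : u w * Avg k g w - g w = g w * (u w * Avg k g w / g w - 1).
  by rewrite mulrBr mulr1 [g w * _]mulrC divfK // lt0r_neq0.
rewrite -mulrDr ler_wpM2l ?(ltW (g0 w)) //.
by move: H (jensen w); lra.
Qed.

Fixpoint avgs (g : {ffun 'I_n -> T} -> R) (s : seq 'I_n) : {ffun 'I_n -> T} -> R :=
  if s is k :: s' then Avg k (avgs g s') else g.

Lemma avgs_gt0 g s : (forall w, 0 < g w) -> forall w, 0 < avgs g s w.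
Proof. by move=> g0; elim: s => //= k s IH w; exact: Avg_gt0. Qed.

Lemma expect_avgs g s : expect (avgs g s) = expect g.
Proof. by elim: s => //= k s IH; rewrite expect_Avg. Qed.

Lemma avgs_indep g s w w' :
  (forall i, i \notin s -> w i = w' i) -> avgs g s w = avgs g s w'.
Proof.
elim: s w w' => /= [|k s IH] w w' ww'.
  by congr g; apply/ffunP => i; exact: ww'.
apply: eq_bigr => t _; congr (_ * _); apply: IH => i iNs.
by rewrite !ffunE; case: eqP => // /eqP ik; apply: ww'; rewrite inE negb_or ik.
Qed.

Lemma avgs_enum g w : avgs g (enum 'I_n) w = expect g.
Proof.
rewrite -(expect_avgs g (enum 'I_n)) -[LHS]expect_cst; apply: eq_expect => w'.
by apply: avgs_indep => i; rewrite mem_enum.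
Qed.

(** Averaging out one coordinate after another leads from [g] to the constant [expect g]. The
    logarithms of the ratios of successive averages telescope, and [entropy_step] bounds each of
    them. The right-hand side has the covariance of [g] and [ln g] in each coordinate, which
    majorizes the entropy there and is easy to symmetrize. *)
Lemma entropy_subadditive g : (forall w, 0 < g w) ->
  expect (fun w => g w * ln (g w)) - expect g * ln (expect g) <=
  \sum_k expect (fun w => g w * (ln (g w) - Avg k (fun w => ln (g w)) w)).
Proof.
move=> g0.
have step s : expect (fun w => g w * (ln (g w) - ln (avgs g s w))) <=
   \sum_(k <- s) expect (fun w => g w * (ln (g w) - Avg k (fun w => ln (g w)) w)).
  elim: s => [|k s IH].
    by rewrite big_nil (eq_expect (h := fun=> 0)) ?expect_cst // => w; rewrite subrr mulr0.
  rewrite big_cons.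
  have := @entropy_step k g (fun w => avgs g s w / avgs g (k :: s) w) g0.
  have u0 w : 0 < avgs g s w / avgs g (k :: s) w.
    by rewrite divr_gt0 // avgs_gt0.
  move=> /(_ u0) H.
  have {}H := lerD (H _) IH; apply: le_trans (H _) => [|w].
    rewrite -expectD; apply: le_expect => w.
    by rewrite ln_div ?posrE ?avgs_gt0 // -mulrDr /=; lra.
  rewrite (@Avg_indep k (avgs g s) (fun w => (avgs g (k :: s) w)^-1)) /=.
    by rewrite divff // lt0r_neq0 // Avg_gt0 // => v; exact: avgs_gt0.
  by move=> v t; rewrite Avg_upd.
have := step (enum 'I_n); rewrite big_enum /=; apply: le_trans.
rewrite -expectZr -expectB; apply: le_expect => w.
by rewrite avgs_enum mulrBr.
Qed.

End FiniteProduct.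

(** * Entropy of bounded processes *)

Section BoundedProcess.
Context {R : realType} {T : finType} {n : nat} {F : Type}.
Implicit Types (k : 'I_n) (w : {ffun 'I_n -> T}) (t : T) (f : F).

Lemma mulr_expR_sub_le (x y : R) :
  (x - y) * (expR x - expR y) <= (x - y) ^+ 2 * (expR x + expR y).
Proof.
wlog xy : x y / y <= x.
  move=> H; have [/H//|/ltW /H] := leP y x.
  by rewrite -(opprB x y) -(opprB (expR x)) mulrNN sqrrN addrC [_ + expR x]addrC.
have H : expR x - expR y <= (x - y) * expR x.
  have := ler_wpM2l (expR_ge0 x) (@expR_ge1Dx R (y - x)).
  by rewrite -expRD subrKC; lra.
have xy0 : 0 <= x - y by rewrite subr_ge0.
apply: le_trans (ler_wpM2l xy0 H) _.
rewrite expr2 -!mulrA; do 2!apply: ler_wpM2l => //.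
by rewrite lerDl expR_ge0.
Qed.

Lemma expR_half_le2 : expR (2^-1) <= 2 :> R.
Proof.
have := @expR_ge1Dx R (- 2^-1); rewrite expRN => H.
have e0 := @expR_gt0 R 2^-1.
have := ler_wpM2r (ltW e0) H; rewrite mulVf ?lt0r_neq0 //; lra.
Qed.

Variable mu : 'I_n -> T -> R.
Hypothesis mu_ge0 : forall i t, 0 <= mu i t.
Hypothesis mu_sum1 : forall i, \sum_t mu i t = 1.
Local Notation Ex := (expect mu).
Local Notation Ex2 := (expect2 mu).

Variable x : F -> 'I_n -> T -> R.
Definition psum f w := \sum_i x f i (w i).
Variable fs : {ffun 'I_n -> T} -> F.
Hypothesis fs_max : forall f w, psum f w <= psum (fs w) w.
Hypothesis x_centered : forall f i, \sum_t mu i t * x f i t = 0.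
Variables (B v : R).
Hypothesis x_le : forall f i t, `|x f i t| <= B.
Hypothesis x_var : forall f, \sum_i \sum_t mu i t * x f i t ^+ 2 <= v.

Let S w := psum (fs w) w.
Let a k w := x (fs w) k (w k).
Let b k w t := x (fs w) k t.
(** The loss made by keeping the maximizer of [w] once the coordinate [k] has become [t]: that
    maximizer then has the value [S w - a k w + b k w t]. *)
Let G k w t := S (upd w k t) - S w + a k w - b k w t.
Let Q k w t := b k w t ^+ 2 + G k w t ^+ 2.

Lemma psum_upd f w k t : psum f (upd w k t) = psum f w - x f k (w k) + x f k t.
Proof.
rewrite /psum (bigD1 k) // [in RHS](bigD1 k) //= upd_eq.
rewrite (eq_bigr (fun i => x f i (w i))) => [|i ik]; last by rewrite upd_neq.
by ring.
Qed.

Let G_ge0 k w t : 0 <= G k w t.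
Proof.
have := fs_max (fs w) (upd w k t).
by rewrite psum_upd /G /S /a /b; lra.
Qed.

Let bounds f i t : - B <= x f i t <= B.
Proof. by rewrite -ler_norml. Qed.

Let S_upd_le k w t : S (upd w k t) <= S w + 2 * B.
Proof.
have := fs_max (fs (upd w k t)) w.
have := psum_upd (fs (upd w k t)) w k t; rewrite -/(S w) -/(S (upd w k t)) => ->.
have /andP[? ?] := bounds (fs (upd w k t)) k (w k).
by have /andP[? ?] := bounds (fs (upd w k t)) k t; lra.
Qed.

Let G_le k w t : G k w t <= 4 * B.
Proof.
have := S_upd_le k w t; rewrite /G /a /b.
have /andP[? ?] := bounds (fs w) k (w k).
by have /andP[? ?] := bounds (fs w) k t; lra.
Qed.

Variable s : R.
Hypothesis s_ge0 : 0 <= s.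
Hypothesis sB : s * B <= 4^-1.

Let e w := expR (s * S w).

Let e_ge0 w : 0 <= e w. Proof. exact: expR_ge0. Qed.

(** One resampling raises [S] by at most [2 * B]; moreover [2 * s * B <= 1/2] and [expR (1/2) <= 2].
    So the weights of resampled points can be exchanged at the cost of a factor 2. *)
Let e_le2 w k t : e (upd w k t) <= 2 * e w.
Proof.
rewrite /e; apply: (@le_trans _ _ (expR (2^-1 + s * S w))).
  rewrite ler_expR; have := ler_wpM2l s_ge0 (S_upd_le k w t).
  by rewrite mulrDr mulrCA; move: sB; lra.
by rewrite expRD ler_wpM2r ?expR_ge0 // expR_half_le2.
Qed.

Let e_ge2 w k t : e w <= 2 * e (upd w k t).
Proof. by have := e_le2 (upd w k t) k (w k); rewrite upd_upd upd_id. Qed.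

(** In [G], the term [b] has mean zero, since [fs w] does not depend on the copy [t]; the increment
    of [S] has nonpositive mean against [e], which is monotone in [S]. What remains is [a k w], and
    these values add up to [S w]. *)
Let Gsum : \sum_k Ex2 k (fun w t => G k w t * e w) <= Ex (fun w => S w * e w).
Proof.
have H k : Ex2 k (fun w t => G k w t * e w) <= Ex (fun w => a k w * e w).
  have -> : Ex2 k (fun w t => G k w t * e w) =
     Ex2 k (fun w t => (S (upd w k t) - S w) * e w) +
     (Ex2 k (fun w _ => a k w * e w) - Ex2 k (fun w t => b k w t * e w)).
    rewrite -expect2N -!expect2D; apply: eq_expect2 => w t.
    by rewrite /G; ring.
  rewrite expect2_fst //.
  have -> : Ex2 k (fun w t => b k w t * e w) = 0.
    transitivity (Ex (fun=> 0)); last exact: expect_cst.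
    apply: eq_expect => w.
    transitivity ((\sum_t mu k t * x (fs w) k t) * e w).
      by rewrite mulr_suml; apply: eq_bigr => t _; rewrite mulrA.
    by rewrite x_centered mul0r.
  rewrite subr0 gerDr.
  have E : Ex2 k (fun w t => (S (upd w k t) - S w) * e w) =
           Ex2 k (fun w t => (S w - S (upd w k t)) * e (upd w k t)).
    by rewrite expect2_swap; apply: eq_expect2 => w t; rewrite upd_upd upd_id.
  (* Added to its image under the swap, the increment becomes minus a product of two differences of
     the same sign. *)
  have : Ex2 k (fun w t => (S (upd w k t) - S w) * e w) *+ 2 <= 0.
    rewrite mulr2n {2}E -expect2D.
    rewrite -(@expect_cst _ _ _ mu mu_sum1 0) -(expect2_fst mu_sum1 k).
    apply: le_expect2 => // w t.
    have -> : (S (upd w k t) - S w) * e w + (S w - S (upd w k t)) * e (upd w k t)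
       = - ((S w - S (upd w k t)) * (e w - e (upd w k t))) by ring.
    rewrite oppr_le0.
    have [h|h] := leP (S w) (S (upd w k t)).
      by apply: mulr_le0; rewrite subr_le0 // ler_expR ler_wpM2l.
    by apply: mulr_ge0; rewrite subr_ge0 ?ler_expR ?ler_wpM2l // ltW.
  by lra.
apply: le_trans (ler_sum _ (fun k _ => H k)) _.
rewrite -expect_sum; apply/ler_sum => w _.
by rewrite -mulr_suml.
Qed.

(** The squares of [b] add up in mean to the variance of the member [fs w], at most [v]; for the
    losses, [G ^+ 2 <= 4 * B * G] leads back to [Gsum]. *)
Let Qsum : \sum_k Ex2 k (fun w t => Q k w t * e w) <=
  v * Ex e + 4 * B * Ex (fun w => S w * e w).
Proof.
apply: (@le_trans _ _ (\sum_k (Ex2 k (fun w t => b k w t ^+ 2 * e w) +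
    4 * B * Ex2 k (fun w t => G k w t * e w)))).
  apply: ler_sum => k _; rewrite -expect2Z -expect2D; apply: le_expect2 => // w t.
  rewrite /Q mulrDl lerD2l expr2 mulrA ler_wpM2r //.
  by rewrite ler_wpM2r.
rewrite big_split -mulr_sumr /= lerD //.
  rewrite /expect2 -expect_sum -expectZ; apply: le_expect => // w.
  apply: (@le_trans _ _ ((\sum_k \sum_t mu k t * x (fs w) k t ^+ 2) * e w)).
    rewrite mulr_suml; apply: ler_sum => k _; rewrite mulr_suml.
    by apply: ler_sum => t _; rewrite mulrA.
  by rewrite ler_wpM2r.
(* [0 <= B] follows from any value of [x], which exists as soon as there is a coordinate; without
   coordinates both sides vanish. *)
case: (pselect (inhabited 'I_n)) => [[k]|N].
  rewrite ler_wpM2l //.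
  have [t _|T0] := pickP (@predT T).
    by have := x_le (fs [ffun=> t]) k t; have := normr_ge0 (x (fs [ffun=> t]) k t); lra.
  by have := mu_sum1 k; rewrite big_pred0 // => /esym/eqP; rewrite oner_eq0.
rewrite big1 => [|k _]; last by case: N.
have -> : Ex (fun w => S w * e w) = Ex (fun=> 0); last by rewrite expect_cst ?mulr0.
apply: eq_expect => w.
by rewrite /S /psum big1 ?mul0r // => k; case: N.
Qed.

(* With three exchangeable values [w k, t, r] of the coordinate [k] and the
   corresponding maximizers, [a_i + a_j = b_ij + b_ji + G_ij + G_ji]; then
   [2 a_0 = (a_0 + a_1) + (a_0 + a_2) - (a_1 + a_2)] bounds [a_0], although the
   maximizer depends on the coordinate [k]. *)
Let three_copies k w t r : a k w ^+ 2 * e w <= 6 *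
  (Q k w t * e w + Q k w r * e w +
   Q k (upd w k t) (w k) * e (upd w k t) + Q k (upd w k t) r * e (upd w k t) +
   Q k (upd w k r) (w k) * e (upd w k r) + Q k (upd w k r) t * e (upd w k r)).
Proof.
have Q0 u z : 0 <= Q k u z by rewrite addr_ge0 ?sqr_ge0.
have e12 := e_ge2 w k t.
have e13 := e_ge2 w k r.
have e11 : e w <= 2 * e w by have := e_ge0 w; lra.
apply: (@le_trans _ _ (3 * ((Q k w t + Q k w r + Q k (upd w k t) (w k)
   + Q k (upd w k t) r + Q k (upd w k r) (w k) + Q k (upd w k r) t) * e w))).
  rewrite mulrA ler_wpM2r //.
  set w1 := upd w k t; set w2 := upd w k r.
  have E01 : a k w + a k w1 = b k w t + b k w1 (w k) + G k w t + G k w1 (w k).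
    by rewrite /G /w1 upd_upd upd_id; ring.
  have E02 : a k w + a k w2 = b k w r + b k w2 (w k) + G k w r + G k w2 (w k).
    by rewrite /G /w2 upd_upd upd_id; ring.
  have E12 : a k w1 + a k w2 = b k w1 r + b k w2 t + G k w1 r + G k w2 t.
    by rewrite /G /w2 /w1 !upd_upd; ring.
  have sq3 (p q r' : R) : (p + q - r') ^+ 2 <= 3 * (p ^+ 2 + q ^+ 2 + r' ^+ 2).
    have := sqr_ge0 (p - q); have := sqr_ge0 (p + r'); have := sqr_ge0 (q + r').
    by rewrite !expr2; lra.
  have sq4 (p q r' z : R) : (p + q + r' + z) ^+ 2 <=
      4 * ((p ^+ 2 + r' ^+ 2) + (q ^+ 2 + z ^+ 2)).
    have := sqr_ge0 (p - q); have := sqr_ge0 (p - r'); have := sqr_ge0 (p - z).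
    have := sqr_ge0 (q - r'); have := sqr_ge0 (q - z); have := sqr_ge0 (r' - z).
    by rewrite !expr2; lra.
  have := sq3 (a k w + a k w1) (a k w + a k w2) (a k w1 + a k w2).
  have -> : a k w + a k w1 + (a k w + a k w2) - (a k w1 + a k w2) = 2 * a k w.
    by ring.
  rewrite E01 E02 E12 exprMn.
  have := sq4 (b k w t) (b k w1 (w k)) (G k w t) (G k w1 (w k)).
  have := sq4 (b k w r) (b k w2 (w k)) (G k w r) (G k w2 (w k)).
  have := sq4 (b k w1 r) (b k w2 t) (G k w1 r) (G k w2 t).
  rewrite -!/(Q k _ _); lra.
have m (q y : R) : 0 <= q -> e w <= 2 * y -> q * e w <= 2 * (q * y).
  by move=> q0 ey; rewrite mulrCA ler_wpM2l.
move: (m _ _ (Q0 w t) e11) (m _ _ (Q0 w r) e11).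
move: (m _ _ (Q0 (upd w k t) (w k)) e12) (m _ _ (Q0 (upd w k t) r) e12).
move: (m _ _ (Q0 (upd w k r) (w k)) e13) (m _ _ (Q0 (upd w k r) t) e13).
by lra.
Qed.

(** By exchangeability, the six terms of [three_copies] have the same mean, whence [36 = 6 * 6]. The
    functional [I] integrates over two further copies of the coordinate [k]. *)
Let asum k : Ex (fun w => a k w ^+ 2 * e w) <=
  36 * Ex2 k (fun w t => Q k w t * e w).
Proof.
set h := fun w t => Q k w t * e w.
pose I g := Ex (fun w => \sum_t mu k t * \sum_r mu k r * g w t r).
have ID g1 g2 : I (fun w t r => g1 w t r + g2 w t r) = I g1 + I g2.
  rewrite -expectD; apply: eq_expect => w; rewrite -big_split; apply: eq_bigr => t _ /=.
  by rewrite -mulrDr -big_split; congr (_ * _); apply: eq_bigr => r _; rewrite mulrDr.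
have I1 g : I (fun w t _ => g w t) = Ex2 k g.
  apply: eq_expect => w; apply: eq_bigr => t _.
  by rewrite -mulr_suml mu_sum1 mul1r.
have IC g : I g = I (fun w t r => g w r t).
  apply: eq_expect => w.
  under eq_bigr do rewrite mulr_sumr; rewrite exchange_big /=.
  apply: eq_bigr => t _; rewrite mulr_sumr; apply: eq_bigr => r _.
  by rewrite mulrCA.
have I2 g : I (fun w t r => g (upd w k t) r) = Ex2 k g.
  exact: (expect_Avg mu_sum1 k (fun w => \sum_t mu k t * g w t)).
have I3 g : I (fun w t _ => g (upd w k t) (w k)) = Ex2 k g.
  by rewrite I1 [RHS]expect2_swap.
have -> : Ex (fun w => a k w ^+ 2 * e w) = I (fun w _ _ => a k w ^+ 2 * e w).
  by rewrite I1 expect2_fst.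
apply: (@le_trans _ _ (I (fun w t r => 6 * (h w t + h w r +
   h (upd w k t) (w k) + h (upd w k t) r +
   h (upd w k r) (w k) + h (upd w k r) t)))).
  apply: le_expect => // w; apply: ler_sum => t _; rewrite ler_wpM2l //.
  by apply: ler_sum => r _; rewrite ler_wpM2l // three_copies.
have -> (g : _ -> _ -> _ -> R) : I (fun w t r => 6 * g w t r) = 6 * I g.
  rewrite -expectZ; apply: eq_expect => w; rewrite mulr_sumr; apply: eq_bigr => t _.
  by rewrite mulrCA; congr (_ * _); rewrite mulr_sumr; apply: eq_bigr => r _; rewrite mulrCA.
rewrite !ID I1 I2 I3.
rewrite (IC (fun w _ r => h w r)) I1 (IC (fun w _ r => h (upd w k r) (w k))) I3.
rewrite (IC (fun w t r => h (upd w k r) t)) I2; lra.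
Qed.

(** With [w'] the resampled point, the swap turns the left-hand side into half the mean of
    [(e w - e w') * (s * S w - s * S w')], and [mulr_expR_sub_le] applies. The weight [e w + e w']
    that it produces counts as twice [e w], again by the swap. *)
Let cov_le k :
  Ex (fun w => e w * (ln (e w) - Avg mu k (fun w => ln (e w)) w)) <=
  s ^+ 2 * Ex2 k (fun w t => (S w - S (upd w k t)) ^+ 2 * e w).
Proof.
have lne w : ln (e w) = s * S w by rewrite expRK.
set X := (X in X <= _).
have X1 : X = Ex2 k (fun w t => e w * (s * S w - s * S (upd w k t))).
  apply: eq_expect => w; rewrite lne /Avg.
  under eq_bigr do rewrite lne.
  under [RHS]eq_bigr do rewrite mulrCA mulrBr.
  by rewrite -mulr_sumr sumrB -mulr_suml mu_sum1 mul1r.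
have X2 : X = Ex2 k (fun w t => e (upd w k t) * (s * S (upd w k t) - s * S w)).
  by rewrite X1 expect2_swap; apply: eq_expect2 => w t; rewrite upd_upd upd_id.
suff : X + X <= 2 * (s ^+ 2 * Ex2 k (fun w t => (S w - S (upd w k t)) ^+ 2 * e w)).
  by lra.
rewrite {1}X1 {1}X2 -expect2D mulrCA.
have -> : 2 * Ex2 k (fun w t => (S w - S (upd w k t)) ^+ 2 * e w) =
  Ex2 k (fun w t => (S w - S (upd w k t)) ^+ 2 * (e w + e (upd w k t))).
  rewrite (@eq_expect2 _ _ _ _ k (fun w t => _ ^+ 2 * (_ + _))
   (fun w t => (S w - S (upd w k t)) ^+ 2 * e w +
      (S w - S (upd w k t)) ^+ 2 * e (upd w k t))); last first.
    by move=> w t; rewrite mulrDr.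
  rewrite expect2D mulr_natl mulr2n; congr (_ + _).
  by rewrite expect2_swap; apply: eq_expect2 => w t; rewrite upd_upd upd_id -sqrrN opprB.
rewrite -expect2Z; apply: le_expect2 => // w t.
have := mulr_expR_sub_le (s * S w) (s * S (upd w k t)).
rewrite -!/(e _) -mulrBr exprMn mulrA.
by apply: le_trans; rewrite le_eqVlt; apply/orP; left; apply/eqP; ring.
Qed.

Lemma entropy_expR_le :
  Ex (fun w => e w * ln (e w)) - Ex e * ln (Ex e) <=
  111 * s ^+ 2 * (v * Ex e + 4 * B * Ex (fun w => S w * e w)).
Proof.
apply: le_trans (entropy_subadditive mu_ge0 mu_sum1 _) _.
  by move=> w; exact: expR_gt0.
apply: le_trans (ler_sum _ (fun k _ => cov_le k)) _.
rewrite -mulr_sumr [leRHS]mulrAC [leRHS]mulrC ler_wpM2l ?sqr_ge0 //.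
apply: le_trans (ler_wpM2l (ler0n _ 111) Qsum).
rewrite mulr_sumr; apply: ler_sum => k _.
(* The decomposition [a - b - G] of the increment costs a factor 3 on squares, and [asum] bounds the
   part of [a] by 36 times that of [Q]. *)
have E (q : R) : 111 * q = 3 * (36 * q + q) by ring.
rewrite E.
apply: le_trans (ler_wpM2l (ler0n _ 3) (lerD (asum k) (lexx _))).
rewrite -(expect2_fst mu_sum1 k) -expect2D -expect2Z; apply: le_expect2 => // w t.
rewrite -mulrDl mulrA ler_wpM2r //.
have -> : S w - S (upd w k t) = a k w - b k w t - G k w t by rewrite /G; ring.
have := sqr_ge0 (a k w + b k w t); have := sqr_ge0 (a k w + G k w t).
have := sqr_ge0 (b k w t - G k w t).
by rewrite /Q !expr2; lra.
Qed.

End BoundedProcess.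

(** * Exponential moments *)

Section Herbst.
Context {R : realType}.

Lemma is_derive_mgf (I : Type) (r : seq I) (c S : I -> R) (s : R) :
  is_derive s 1 (fun s => \sum_(i <- r) c i * expR (s * S i))
    (\sum_(i <- r) c i * (S i * expR (s * S i))).
Proof.
elim: r => [|i r IH].
  under eq_fun do rewrite big_nil.
  rewrite big_nil; exact: is_derive_cst.
under eq_fun do rewrite big_cons.
rewrite big_cons; apply: is_deriveD.
have D : is_derive s 1 (fun s => s * S i) (S i).
  by apply: is_derive_eq; rewrite scaler0 add0r /GRing.scale /= mulr1.
have D1 : is_derive s 1 (fun s => expR (s * S i)) (expR (s * S i) * S i).
  exact: (@is_derive1_comp _ expR (fun s => s * S i)).
apply: is_derive_eq; rewrite /GRing.scale /= ?mul0r ?mulr0 ?addr0.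
by rewrite [S i * _]mulrC.
Qed.

(** [L] stands for the logarithm of a moment generating function. Divided by [s ^+ 2], the entropy
    inequality says that [H] below is nonincreasing, and its upper limit at 0 is at most [M]. The 16
    is [4 * B] for the bound [B = 4]. *)
Lemma herbst (L L' : R -> R) (M v C t0 : R) :
  0 < t0 ->
  (forall s : R, 0 < s -> is_derive s 1 L (L' s)) ->
  (forall s : R, 0 < s <= t0 -> s * L' s - L s <= C * s ^+ 2 * (v + 16 * L' s)) ->
  (forall s : R, 0 < s -> 0 <= L s) -> 0 <= C -> 0 <= v ->
  (exists A : R, forall s : R, 0 < s <= 1 -> L s <= s * (M + s * A)) ->
  t0^-1 * L t0 <= M + C * v * t0 + 16 * C * L t0.
Proof.
move=> t00 dL entL L0 C0 v0 [A LA].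
pose H s := s^-1 * L s - (C * v * s + 16 * C * L s).
pose dH s := (s^-1 * L' s - s ^- 2 * L s) - (C * v + 16 * C * L' s).
have dHP (s : R) : 0 < s -> is_derive s 1 H (dH s).
  move=> s0; have D := dL s s0.
  have DV : is_derive s 1 (fun s : R => s^-1) (- s ^- 2).
    have := @is_deriveV R id s 1 1 (lt0r_neq0 s0) _.
    by rewrite /GRing.scale /= mulr1; exact.
  have D2 : is_derive s 1 (fun s => s^-1 * L s) (s^-1 * L' s - s ^- 2 * L s).
    apply: is_derive_eq; rewrite /GRing.scale /=.
    by rewrite [L s * _]mulrC mulNr.
  have D3 : is_derive s 1 (fun s => C * v * s + 16 * C * L s) (C * v + 16 * C * L' s).
    apply: is_derive_eq; rewrite /GRing.scale /=.
    by rewrite mulr1.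
  exact: is_deriveB.
have dH0 (s : R) : 0 < s <= t0 -> dH s <= 0.
  move=> /andP[s0 st0]; have := entL s; rewrite s0 => /(_ st0) e.
  have s2 : 0 < s ^+ 2 by rewrite exprn_gt0.
  rewrite -(pmulr_rle0 _ s2) /dH.
  suff -> : s ^+ 2 * (s^-1 * L' s - s ^- 2 * L s - (C * v + 16 * C * L' s)) =
     s * L' s - L s - C * s ^+ 2 * (v + 16 * L' s) by rewrite subr_le0.
  by field; rewrite lt0r_neq0.
suff Ht : H t0 <= M by move: Ht; rewrite /H; lra.
apply/ler_addgt0Pr => eps eps0.
have A0 : 0 < `|A| + 1 by rewrite ltr_wpDl.
(* At this [s] the last hypothesis gives [s^-1 * L s <= M + eps]; the [+ 1] keeps the denominator
   positive. *)
pose s := Num.min 1 (Num.min t0 (eps / (`|A| + 1))).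
have s0 : 0 < s by rewrite !lt_min ltr01 t00 divr_gt0.
have s1 : s <= 1 by rewrite ge_min lexx.
have st : s <= t0 by rewrite !ge_min lexx orbT.
have se : s <= eps / (`|A| + 1) by rewrite !ge_min lexx !orbT.
apply: (@le_trans _ _ (H s)).
  apply: (@ler0_derive1_nincr _ H s t0) => //.
  - by move=> u; rewrite in_itv /= => /andP[su _]; have [] := dHP u (lt_trans s0 su).
  - move=> u; rewrite in_itv /= => /andP[su ut].
    rewrite derive1E; have [_ ->] := dHP u (lt_trans s0 su).
    by rewrite dH0 // (lt_trans s0 su) ltW.
  - apply: derivable_within_continuous => u; rewrite in_itv /= => /andP[su _].
    by have [] := dHP u (lt_le_trans s0 su).
have : s^-1 * L s <= M + eps.
  rewrite mulrC ler_pdivrMr // mulrC.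
  apply: le_trans (LA s _) _; first by rewrite s0.
  rewrite ler_wpM2l ?(ltW s0) // lerD2l.
  apply: (@le_trans _ _ (s * (`|A| + 1))).
    by rewrite ler_wpM2l ?(ltW s0) // (le_trans (ler_norm _)) // lerDl.
  by rewrite -ler_pdivlMr.
have : 0 <= C * v * s by rewrite !mulr_ge0 // ltW.
have : 0 <= 16 * C * L s by rewrite !mulr_ge0 // L0.
by rewrite /H; lra.
Qed.

End Herbst.

Section ExponentialMoment.
Context {R : realType} {T : finType} {n : nat} {F : Type}.
Implicit Types (k : 'I_n) (w : {ffun 'I_n -> T}) (t : T) (f : F).
Variable mu : 'I_n -> T -> R.
Hypothesis mu_ge0 : forall i t, 0 <= mu i t.
Hypothesis mu_sum1 : forall i, \sum_t mu i t = 1.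
Local Notation Ex := (expect mu).

Variable x : F -> 'I_n -> T -> R.
Variable fs : {ffun 'I_n -> T} -> F.
Hypothesis fs_max : forall f w, psum x f w <= psum x (fs w) w.
Hypothesis x_centered : forall f i, \sum_t mu i t * x f i t = 0.
Variable v : R.
Hypothesis x_le4 : forall f i t, `|x f i t| <= 4.
Hypothesis x_var : forall f, \sum_i \sum_t mu i t * x f i t ^+ 2 <= v.

Lemma expect_psum f : Ex (psum x f) = 0.
Proof.
rewrite /psum expect_sum big1 // => i _.
by rewrite (expect_coord mu_sum1 i (x f i)) x_centered.
Qed.

Lemma expect_psum_max_ge0 : 0 <= Ex (fun w => psum x (fs w) w).
Proof.
case: (pselect (exists w : {ffun 'I_n -> T}, True)) => [[w _]|N].
  by rewrite -(expect_psum (fs w)); apply: le_expect => // w'; exact: fs_max.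
by rewrite /expect big1 // => w; case: N; exists w.
Qed.

(* 3552 = 2 * 16 * 111, so that the last term of [herbst] with [C = 111] is at
   most half of its left-hand side. *)
Lemma expect_expR_le (c : R) : 3552 <= c ->
  Ex (fun w => expR (c^-1 * psum x (fs w) w)) <=
  expR (Ex (fun w => psum x (fs w) w) + v).
Proof.
move=> c_ge; have c16 : 16 <= c by lra.
have c_gt0 : 0 < c by lra.
have t0 : 0 < c^-1 by rewrite invr_gt0.
have t16 : c^-1 <= 16^-1 by rewrite lef_pV2 ?posrE //; lra.
set S := fun w => psum x (fs w) w.
pose m s := Ex (fun w => expR (s * S w)).
pose m' s := Ex (fun w => S w * expR (s * S w)).
have ES0 : 0 <= Ex S := expect_psum_max_ge0.
have [w0|T0] := pickP (@predT {ffun 'I_n -> T}); last first.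
  by have /eqP := expect_cst mu_sum1 1; rewrite /expect big_pred0 // eq_sym oner_eq0.
have v0 : 0 <= v.
  apply: le_trans (x_var (fs w0)); apply: sumr_ge0 => i _; apply: sumr_ge0 => t _.
  by rewrite mulr_ge0 // sqr_ge0.
have m_ge1 s : 0 < s -> 1 <= m s.
  move=> s0; apply: (@le_trans _ _ (Ex (fun w => 1 + s * S w))).
    by rewrite expectD expect_cst // expectZ lerDl mulr_ge0 // ltW.
  by apply: le_expect => // w; exact: expR_ge1Dx.
have m_gt0 s : 0 < s -> 0 < m s by move=> /m_ge1; apply: lt_le_trans.
have := @herbst _ (fun s => ln (m s)) (fun s => m' s / m s) (Ex S) v 111 c^-1 t0.
have H1 (s : R) : 0 < s -> is_derive s 1 (fun s => ln (m s)) (m' s / m s).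
  move=> s0; rewrite mulrC.
  have D := is_derive_mgf (index_enum _) (pmass mu) S s.
  have D1 := is_derive1_ln (m_gt0 s s0).
  exact: (@is_derive1_comp _ (@ln R) m).
move=> /(_ H1).
have H2 s : 0 < s <= c^-1 -> s * (m' s / m s) - ln (m s) <=
    111 * s ^+ 2 * (v + 16 * (m' s / m s)).
  move=> /andP[s0 st].
  have s4 : s * 4 <= 4^-1 by lra.
  have := entropy_expR_le mu_ge0 mu_sum1 fs_max x_centered x_le4 x_var (ltW s0) s4.
  rewrite (eq_expect mu (h := fun w => s * (S w * expR (s * S w)))); last first.
    by move=> w; rewrite expRK mulrC mulrA.
  rewrite expectZ -/(m s) -/(m' s) => e.
  have ms := m_gt0 s s0.
  rewrite -(ler_pM2r ms).
  have -> : (s * (m' s / m s) - ln (m s)) * m s = s * m' s - m s * ln (m s).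
    by field; rewrite lt0r_neq0.
  have -> : 111 * s ^+ 2 * (v + 16 * (m' s / m s)) * m s =
    111 * s ^+ 2 * (v * m s + 16 * m' s).
    by field; rewrite lt0r_neq0.
  by have -> : 16 = 4 * 4 :> R by lra.
have H3 s : 0 < s -> 0 <= ln (m s) by move=> s0; rewrite ln_ge0 // m_ge1.
have H4 : exists A : R, forall s : R, 0 < s <= 1 -> ln (m s) <= s * (Ex S + s * A).
  (* With [y = s * S w], one has [expR y - 1 - y <= y * (expR y - 1) <= y ^+ 2 * (expR y + 1)],
     where [s <= 1] removes [s] from the last exponential; the logarithm is bounded by [m s - 1]. *)
  exists (Ex (fun w => S w ^+ 2 * (expR `|S w| + 1))) => s /andP[s0 s1].
  apply: (@le_trans _ _ (m s - 1)).
    by have := @ln_leB1 R _ 1 (m_gt0 s s0) ltr01; rewrite ln1 add0r divr1.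
  rewrite -expectZ -expectD -expectZ -[X in m s - X](expect_cst mu_sum1) -expectB.
  apply: le_expect => // w.
  have := mulr_expR_sub_le (s * S w) 0; rewrite expR0 !subr0.
  have e1 : expR (s * S w) <= expR `|S w|.
    rewrite ler_expR (le_trans (ler_norm _)) // normrM gtr0_norm //.
    by rewrite ler_piMl.
  have e2 : expR (s * S w) - 1 <= s * S w * expR (s * S w).
    have := ler_wpM2l (expR_ge0 (s * S w)) (@expR_ge1Dx R (- (s * S w))).
    by rewrite -expRD subrr expR0; lra.
  have e3 : 0 <= (s * S w) ^+ 2 by rewrite sqr_ge0.
  have := ler_wpM2l e3 e1; rewrite exprMn.
  by move: e2; lra.
move=> /(_ H2 H3 (ler0n _ _) v0 H4).
rewrite invrK => H.
rewrite -/(m c^-1) -[leLHS]lnK ?posrE ?m_gt0 // ler_expR.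
have l0 := H3 _ t0; set l := ln _ in H l0 *.
have cl : 3552 * l <= c * l by rewrite ler_wpM2r.
have vc : v * c^-1 <= v * 16^-1 by rewrite ler_wpM2l.
by move: H; rewrite -(mulrA 111); move: cl vc l0 ES0 v0; lra.
Qed.

End ExponentialMoment.

(** * Truncation *)

Section PowerInequalities.
Context {R : realType}.
Implicit Types a b c p u y z : R.

Lemma ler_powR2r a b p : 0 <= p -> 0 <= a -> a <= b -> a `^ p <= b `^ p.
Proof.
move=> p0 a0 ab; apply: ge0_ler_powR => //; rewrite nnegrE //.
exact: le_trans ab.
Qed.

(** If [p * y <= u], then [u + y] is at most [1 + 1/p] times [u], and the power [p - 1] of [1 + 1/p]
    is at most e, hence 4; otherwise [u + y < (p + 1) * y]. The factor of [u] must not grow with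
    [p], because that term is absorbed later. *)
Lemma powR_pred_addr_le u y p : 1 <= p -> 0 <= u -> 0 <= y ->
  (u + y) `^ (p - 1) <= 4 * u `^ (p - 1) + (p + 1) `^ (p - 1) * y `^ (p - 1).
Proof.
move=> p1 u0 y0; have p0 : 0 < p by lra.
have q0 : 0 <= p - 1 by lra.
have [yu|uy] := leP (p * y) u.
  apply: (@le_trans _ _ (4 * u `^ (p - 1))); last first.
    by rewrite lerDl mulr_ge0 ?powR_ge0.
  apply: (@le_trans _ _ (((1 + p^-1) * u) `^ (p - 1))).
    apply: ler_powR2r => //; first exact: addr_ge0.
    by rewrite mulrDl mul1r lerD2l mulrC ler_pdivlMr // mulrC.
  have ip : 0 < p^-1 by rewrite invr_gt0.
  rewrite powRM //; last by lra.
  rewrite ler_wpM2r ?powR_ge0 //.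
  apply: (@le_trans _ _ (expR (p^-1) `^ (p - 1))).
    by apply: ler_powR2r => //; [lra | exact: expR_ge1Dx].
  rewrite -expRM; apply: (@le_trans _ _ (expR (2^-1 + 2^-1))).
    by rewrite ler_expR mulrBr mulVf ?lt0r_neq0 // mulr1; lra.
  have := @expR_half_le2 R; have := @expR_ge0 R 2^-1; rewrite expRD => h0 h2.
  have -> : 4 = 2 * 2 :> R by lra.
  exact: ler_pM.
rewrite -powRM //; last by lra.
apply: (@le_trans _ _ (((p + 1) * y) `^ (p - 1))).
  apply: ler_powR2r => //; first exact: addr_ge0.
  by rewrite mulrDl mul1r lerD2r ltW.
by rewrite lerDr mulr_ge0 ?powR_ge0.
Qed.

(** According to whether [z] is below or above [a]. For large [a], a moment of order [p - 1] becomes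
    a small multiple of the one of order [p]. *)
Lemma powR_pred_le a z p : 1 <= p -> 0 < a -> 0 <= z ->
  z `^ (p - 1) <= z `^ p / a + a `^ (p - 1).
Proof.
move=> p1 a0 z0; have q0 : 0 <= p - 1 by lra.
have p0 : 0 < p by lra.
have [za|az] := leP z a.
  apply: (@le_trans _ _ (a `^ (p - 1))); first exact: ler_powR2r.
  by rewrite lerDr divr_ge0 ?powR_ge0 // ltW.
apply: (@le_trans _ _ (z `^ p / a)); last by rewrite lerDl powR_ge0.
by rewrite ler_pdivlMr // mulrC -(mulr_powRB1 z0 p0) ler_wpM2r ?powR_ge0 // ltW.
Qed.

Lemma powRD3_le a b c p : 0 <= p -> 0 <= a -> 0 <= b -> 0 <= c ->
  (a + b + c) `^ p <= 3 `^ p * (a `^ p + b `^ p + c `^ p).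
Proof.
move=> p0 a0 b0 c0; set m := Num.max a (Num.max b c).
have ma : a <= m by rewrite le_max lexx.
have mb : b <= m by rewrite !le_max lexx orbT.
have mc : c <= m by rewrite !le_max lexx !orbT.
have m0 : 0 <= m by exact: le_trans ma.
apply: (@le_trans _ _ ((3 * m) `^ p)).
  by apply: ler_powR2r; rewrite ?addr_ge0 //; lra.
rewrite powRM // ler_wpM2l ?powR_ge0 //.
have := powR_ge0 a p; have := powR_ge0 b p; have := powR_ge0 c p.
rewrite /m /Num.max; case: ifP => _; last by lra.
by case: ifP => _; lra.
Qed.

(** For positive [z], this is [u <= expR u] at [u = z / (c * p)], raised to the power [p]. *)
Lemma powR_pos_le c z p : 1 <= p -> 0 < c ->
  Num.max z 0 `^ p <= (c * p) `^ p * expR (c^-1 * z).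
Proof.
move=> p1 c0; have p0 : 0 < p by lra.
have [z0|z0] := leP z 0.
  by rewrite powR0 ?gt_eqF // mulr_ge0 ?powR_ge0 ?expR_ge0.
have cp : 0 < c * p by exact: mulr_gt0.
have -> : c^-1 * z = (z / (c * p)) * p by field; rewrite !lt0r_neq0.
rewrite expRM -powRM ?expR_ge0 ?(ltW cp) //.
apply: ler_powR2r; rewrite ?(ltW p0) ?(ltW z0) // mulrC -ler_pdivrMr //.
by apply: le_trans (@expR_ge1Dx R _); rewrite lerDr.
Qed.

End PowerInequalities.

(** * Moments of sums of independent nonnegative variables *)

Section NonnegativeSums.
Context {R : realType} {T : finType} {n : nat}.
Implicit Types (i k : 'I_n) (w : {ffun 'I_n -> T}) (t : T).
Variable mu : 'I_n -> T -> R.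
Hypothesis mu_ge0 : forall i t, 0 <= mu i t.
Hypothesis mu_sum1 : forall i, \sum_t mu i t = 1.
Local Notation Ex := (expect mu).
Variables (xi : 'I_n -> T -> R) (p : R).
Hypothesis p_ge1 : 1 <= p.
Hypothesis xi_ge0 : forall i t, 0 <= xi i t.
Hypothesis xi_mean : \sum_i \sum_t mu i t * xi i t <= 2.
Hypothesis xi_pow : \sum_i \sum_t mu i t * xi i t `^ p <= 2.

(** One factor of the power of [W] is expanded as a sum. In the term of [xi i], the remaining sum
    [Wm i] is independent of it, and the means of the [xi i] add up to at most 2. The moment of
    order [p - 1] obtained in this way is absorbed into the left-hand side. *)
Lemma expect_sum_powR_le : Ex (fun w => (\sum_i xi i (w i)) `^ p) <= (32 * p) `^ p.
Proof.
have p1 := p_ge1; have p0 : 0 < p by exact: lt_le_trans p_ge1.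
have q0 : 0 <= p - 1 by rewrite subr_ge0.
set W := fun w => \sum_i xi i (w i).
pose Wm i w := \sum_(j | j != i) xi j (w j).
have W0 w : 0 <= W w by exact: sumr_ge0.
have Wm0 i w : 0 <= Wm i w by exact: sumr_ge0.
have WE i w : W w = Wm i w + xi i (w i) by rewrite /W (bigD1 i) //= addrC.
have WmW i w : Wm i w <= W w by rewrite (WE i) lerDl.
have Wm_indep i w t : Wm i (upd w i t) = Wm i w.
  by apply: eq_bigr => j ji; rewrite upd_neq.
have H : Ex (fun w => W w `^ p) <=
    8 * Ex (fun w => W w `^ (p - 1)) + 2 * (p + 1) `^ (p - 1).
  apply: (@le_trans _ _ (\sum_i Ex (fun w => xi i (w i) *
    (4 * Wm i w `^ (p - 1)) + (p + 1) `^ (p - 1) * xi i (w i) `^ p))).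
    rewrite -expect_sum; apply: le_expect => // w.
    rewrite -(mulr_powRB1 (W0 w)) // {1}/W mulr_suml; apply: ler_sum => i _.
    rewrite -(mulr_powRB1 (xi_ge0 i (w i))) //.
    rewrite [X in _ <= _ + X]mulrCA -mulrDr ler_wpM2l //.
    by rewrite (WE i) powR_pred_addr_le.
  apply: (@le_trans _ _ (\sum_i ((\sum_t mu i t * xi i t) *
     (4 * Ex (fun w => W w `^ (p - 1))) +
     (p + 1) `^ (p - 1) * (\sum_t mu i t * xi i t `^ p)))).
    apply: ler_sum => i _; rewrite expectD expectZ (expect_coord mu_sum1 i (fun t => xi i t `^ p)).
    rewrite lerD2r expect_indep // => [|w t]; last by rewrite Wm_indep.
    rewrite ler_wpM2l ?sumr_ge0 // => [t _|]; first exact: mulr_ge0.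
    by rewrite expectZ ler_wpM2l // le_expect // => w; rewrite ler_powR2r.
  rewrite big_split /= -mulr_suml -mulr_sumr [X in _ + X <= _]mulrC.
  apply: lerD; last by rewrite ler_wpM2r ?powR_ge0.
  have -> : 8 = 2 * 4 :> R by lra.
  rewrite -mulrA ler_wpM2r // mulr_ge0 // expect_ge0 // => w; exact: powR_ge0.
(* At the level 16, the term with factor 8 in [H] costs half the moment of order [p], plus half of
   16 to the power [p]. *)
have H2 : Ex (fun w => W w `^ (p - 1)) <= Ex (fun w => W w `^ p) / 16 + 16 `^ (p - 1).
  rewrite -expectZr -[X in _ <= _ + X](expect_cst mu_sum1) -expectD; apply: le_expect => // w.
  exact: powR_pred_le.
have H3 : 16 * 16 `^ (p - 1) = 16 `^ p :> R by rewrite mulr_powRB1.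
have H4 : 4 * (p + 1) `^ (p - 1) <= (16 * p) `^ p.
  apply: (@le_trans _ _ (8 `^ p * (2 * p) `^ p)); last first.
    rewrite -powRM //; last by lra.
    by rewrite le_eqVlt; apply/orP; left; apply/eqP; congr (_ `^ _); ring.
  apply: ler_pM; rewrite ?powR_ge0 //.
    by apply: (@le_trans _ _ 8); [lra | apply: le1r_powR => //; lra].
  apply: (@le_trans _ _ ((2 * p) `^ (p - 1))); first by apply: ler_powR2r => //; lra.
  by apply: ler_powR; lra.
have H5 : 16 `^ p <= (16 * p) `^ p by apply: ler_powR2r; lra.
have H6 : 2 * (16 * p) `^ p <= (32 * p) `^ p.
  apply: (@le_trans _ _ (2 `^ p * (16 * p) `^ p)).
    by rewrite ler_wpM2r ?powR_ge0 // le1r_powR //; lra.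
  rewrite -powRM //; last by lra.
  by rewrite le_eqVlt; apply/orP; left; apply/eqP; congr (_ `^ _); ring.
by move: H H2 H3 H4 H5 H6; lra.
Qed.

End NonnegativeSums.

(** * Truncation by the envelope, and the upper tail *)

Section Truncation.
Context {R : realType} {T : finType} {n : nat} {F : finType}.
Implicit Types (i k : 'I_n) (w : {ffun 'I_n -> T}) (t : T) (f : F).
Variable mu : 'I_n -> T -> R.
Hypothesis mu_ge0 : forall i t, 0 <= mu i t.
Hypothesis mu_sum1 : forall i, \sum_t mu i t = 1.
Local Notation Ex := (expect mu).
Variable x : F -> 'I_n -> T -> R.
Variables (M : {ffun 'I_n -> T} -> R) (p : R).
Hypothesis p_ge1 : 1 <= p.
Hypothesis x_le : forall f i w, `|x f i (w i)| <= M w.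
Hypothesis M_ge0 : forall w, 0 <= M w.
Hypothesis M_pow : Ex (fun w => M w `^ p) <= 1.

Definition env i t := \big[Num.max/0]_f `|x f i t|.
(** The level is a constant because the moment of [M] is normalized to 1. An envelope above it
    counts in full, so that [exceed] dominates all that truncation removes. *)
Definition exceed i t := if env i t <= 2 then 0 else env i t.

Lemma env_ge0 i t : 0 <= env i t.
Proof. exact: bigmax_ge_id. Qed.

Lemma le_env f i t : `|x f i t| <= env i t.
Proof. exact: (le_bigmax 0 (fun f => `|x f i t|) f). Qed.

Lemma exceed_ge0 i t : 0 <= exceed i t.
Proof. by rewrite /exceed; case: ifP => // _; exact: env_ge0. Qed.

Lemma env_le i w : env i (w i) <= M w.
Proof. by apply: bigmax_le => // f _; exact: x_le. Qed.

Let p_gt0 : 0 < p. Proof. exact: lt_le_trans p_ge1. Qed.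

Let all_small w := [forall i, env i (w i) <= 2].

(** Markov's inequality: off this event [M w >= 2], so its power [p] is at least 2. *)
Lemma expect_all_small : 2^-1 <= Ex (fun w => (all_small w)%:R).
Proof.
have : Ex (fun w => 1 - (all_small w)%:R) <= 2^-1 * Ex (fun w => M w `^ p).
  rewrite -expectZ; apply: le_expect => // w; rewrite /all_small.
  case: forallP => [_|/existsNP[i /negP]]; rewrite ?subrr ?subr0.
    by rewrite mulr_ge0 ?powR_ge0.
  rewrite -ltNge => i2; rewrite -ler_pdivrMl // invrK mulr1.
  have M2 : 2 <= M w by apply: le_trans (env_le i w); exact: ltW.
  apply: le_trans (ler_powR2r (ltW p_gt0) _ M2) => //.
  by apply: le1r_powR; rewrite ?ler1n.
by rewrite expectB expect_cst //; move: M_pow; lra.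
Qed.

(** The events that the coordinate [i] alone exceeds the level are disjoint, so on them the powers
    add up to at most that of [M]. The condition [others i] is independent of the coordinate [i] and
    has probability at least 1/2, as [all_small] implies it; this costs the factor 2. *)
Lemma sum_exceed_pow : \sum_i \sum_t mu i t * exceed i t `^ p <= 2.
Proof.
pose others i w := [forall j, (j != i) ==> (env j (w j) <= 2)].
have H : \sum_i Ex (fun w => exceed i (w i) `^ p * (others i w)%:R) <= 1.
  rewrite -expect_sum; apply: le_trans M_pow; apply: le_expect => // w.
  case: (pickP [pred i | (2 < env i (w i)) && others i w]) => [i|N].
    move=> /= /andP[i2 /forallP oi].
    rewrite (bigD1 i) //= big1 ?addr0 => [|j ji].
      rewrite (_ : others i w) ?mulr1; last exact/forallP.
      apply: ler_powR2r; rewrite ?(ltW p_gt0) ?exceed_ge0 //.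
      by rewrite /exceed (leNgt _ 2) i2 env_le.
    have /implyP/(_ ji) := oi j.
    by rewrite /exceed => ->; rewrite powR0 ?gt_eqF // mul0r.
  rewrite big1 ?powR_ge0 // => i _.
  have := N i; rewrite /= /exceed leNgt; case: ltP => /= _.
    by move=> ->; rewrite mulr0.
  by rewrite powR0 ?gt_eqF // mul0r.
have H2 i : 2^-1 * (\sum_t mu i t * exceed i t `^ p) <=
    Ex (fun w => exceed i (w i) `^ p * (others i w)%:R).
  rewrite (@expect_indep _ _ _ _ mu_sum1 i (fun t => exceed i t `^ p)) //.
    rewrite mulrC ler_wpM2l //.
      by apply: sumr_ge0 => t _; rewrite mulr_ge0 ?powR_ge0.
    apply: le_trans expect_all_small _; apply: le_expect => // w.
    rewrite ler_nat; case: (boolP (all_small w)) => // /forallP a.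
    by rewrite lt0b; apply/forallP => j; apply/implyP => _; exact: a.
  move=> w t; congr (nat_of_bool _)%:R; apply: eq_forallb => j.
  by case: (eqVneq j i) => //= ji; rewrite upd_neq.
have := ler_sum (index_enum _) (fun i (_ : xpredT i) => H2 i).
by rewrite -mulr_sumr; move: H; lra.
Qed.

(** A nonzero value of [exceed] is larger than 2, hence at most its own power [p]. *)
Lemma sum_exceed : \sum_i \sum_t mu i t * exceed i t <= 2.
Proof.
apply: le_trans sum_exceed_pow.
apply: ler_sum => i _; apply: ler_sum => t _; rewrite ler_wpM2l //.
rewrite /exceed; case: (leP (env i t) 2) => [_|h]; first exact: powR_ge0.
by apply: le1r_powR => //; apply: le_trans (ltW h); rewrite ler1n.
Qed.

Hypothesis x_centered : forall f i, \sum_t mu i t * x f i t = 0.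
Hypothesis x_var : forall f, \sum_i \sum_t mu i t * x f i t ^+ 2 <= p.
Variable c : R.
Hypothesis c_ge : 3552 <= c.

(** The envelope decides the truncation, so the same points [t] are cut for all members of the class
    and the error is uniform in [f]. *)
Let small f i t := if env i t <= 2 then x f i t else 0.
Let csmall f i := \sum_t mu i t * small f i t.
Let y f i t := small f i t - csmall f i.

Let small_le f i t : `|small f i t| <= 2.
Proof.
rewrite /small; case: (leP (env i t) 2) => [|_]; last by rewrite normr0.
exact: le_trans (le_env f i t).
Qed.

Let csmall_le f i : `|csmall f i| <= 2.
Proof.
apply: le_trans (ler_norm_sum _ _ _) _.
apply: (@le_trans _ _ (\sum_t mu i t * 2)); last by rewrite -mulr_suml mu_sum1 mul1r.
by apply: ler_sum => t _; rewrite normrM ger0_norm // ler_wpM2l.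
Qed.

Let y_le f i t : `|y f i t| <= 4.
Proof.
apply: le_trans (ler_normB _ _) _.
by have := small_le f i t; have := csmall_le f i; lra.
Qed.

Let y_centered f i : \sum_t mu i t * y f i t = 0.
Proof.
under eq_bigr do rewrite mulrBr.
by rewrite sumrB -mulr_suml mu_sum1 mul1r subrr.
Qed.

Let y_var f : \sum_i \sum_t mu i t * y f i t ^+ 2 <= p.
Proof.
apply: le_trans (x_var f); apply: ler_sum => i _.
apply: (@le_trans _ _ (\sum_t mu i t * small f i t ^+ 2)); last first.
  apply: ler_sum => t _; rewrite ler_wpM2l // /small; case: ifP => // _.
  by rewrite expr0n sqr_ge0.
have -> : \sum_t mu i t * y f i t ^+ 2 =
    \sum_t mu i t * small f i t ^+ 2 - csmall f i ^+ 2.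
  transitivity (\sum_t (mu i t * small f i t ^+ 2 -
     2 * csmall f i * (mu i t * small f i t) + mu i t * csmall f i ^+ 2)).
    by apply: eq_bigr => t _; rewrite /y; ring.
  rewrite big_split /= sumrB -mulr_sumr -mulr_suml mu_sum1 -/(csmall f i); ring.
by rewrite gerBl sqr_ge0.
Qed.

Let W w := \sum_i exceed i (w i).

(** Truncation moves the sum by at most [W w]. As [x f i] is centered, [csmall f i] is minus the
    mean of the removed part, so recentering moves the sum by at most 2, by [sum_exceed]. *)
Let psum_close f w : `|psum x f w - psum y f w| <= W w + 2.
Proof.
rewrite /psum -sumrB.
have D i t : `|x f i t - small f i t| <= exceed i t.
  rewrite /small /exceed; case: ifP => _; first by rewrite subrr normr0.
  by rewrite subr0 le_env.
have -> : \sum_i (x f i (w i) - y f i (w i)) =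
    \sum_i ((x f i (w i) - small f i (w i)) + csmall f i).
  by apply: eq_bigr => i _; rewrite /y; ring.
rewrite big_split /=; apply: le_trans (ler_normD _ _) _; apply: lerD.
  by apply: le_trans (ler_norm_sum _ _ _) _; apply: ler_sum => i _.
apply: le_trans sum_exceed.
apply: le_trans (ler_norm_sum _ _ _) _; apply: ler_sum => i _.
have -> : csmall f i = - \sum_t mu i t * (x f i t - small f i t).
  under eq_bigr do rewrite mulrBr.
  by rewrite sumrB x_centered sub0r opprK.
rewrite normrN; apply: le_trans (ler_norm_sum _ _ _) _; apply: ler_sum => t _.
by rewrite normrM ger0_norm // ler_wpM2l.
Qed.

Variable fs : {ffun 'I_n -> T} -> F.
Hypothesis fs_max : forall f w, psum x f w <= psum x (fs w) w.
Let S w := psum x (fs w) w.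
Hypothesis S_mean : Ex S <= p.

(** The positive part of [S] is at most the sum of that of [Sy], of [W] and of 2. They are
    controlled by [expect_expR_le], by [expect_sum_powR_le] and trivially. In [9 = 3 * 3], one
    factor comes from [powRD3_le] and the other from adding three equal bounds. *)
Lemma expect_pos_powR_le :
  Ex (fun w => Num.max (S w) 0 `^ p) <= (9 * (c * expR 6) * p) `^ p.
Proof.
pose gs w := [arg max_(f > fs w) psum y f w]%O.
have gs_max f w : psum y f w <= psum y (gs w) w.
  by rewrite /gs; case: arg_maxP => //= g _; exact.
pose Sy w := psum y (gs w) w.
have EW : Ex W <= 2.
  rewrite expect_sum (eq_bigr (fun i => \sum_t mu i t * exceed i t)) ?sum_exceed //.
  by move=> i _; rewrite (expect_coord mu_sum1 i (exceed i)).
have W0 w : 0 <= W w by apply: sumr_ge0 => i _; exact: exceed_ge0.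
have SSy w : S w <= Sy w + W w + 2.
  have := psum_close (fs w) w; rewrite ler_norml => /andP[_].
  by have := gs_max (fs w) w; rewrite /S /Sy; lra.
have SyS w : Sy w <= S w + W w + 2.
  have := psum_close (gs w) w; rewrite ler_norml => /andP[+ _].
  by have := fs_max (gs w) w; rewrite /S /Sy; lra.
have ESy : Ex Sy <= 5 * p.
  apply: (@le_trans _ _ (Ex (fun w => S w + W w + 2))); first exact: le_expect.
  by rewrite !expectD expect_cst //; move: S_mean EW p_ge1; lra.
have exp_bd := expect_expR_le mu_ge0 mu_sum1 gs_max y_centered y_le y_var c_ge.
(* [Ex Sy <= 5 * p] and the variance bound [p] make the exponent in [exp_bd] at most [6 * p]. *)
set K0 := c * expR 6.
have cp0 : 0 < c := lt_le_trans (ltr0Sn _ _) c_ge.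
have c0 := ltW cp0.
have p0 := p_gt0; have p1 := p_ge1.
have e0 := @expR_gt0 R 6.
have K0_ge : 3552 <= K0.
  apply: le_trans c_ge _.
  by rewrite /K0 ler_peMr // -[leLHS](@expR0 R) ler_expR.
have K0p : 0 <= K0 * p by apply: mulr_ge0; lra.
have HS : Ex (fun w => Num.max (Sy w) 0 `^ p) <= (K0 * p) `^ p.
  apply: (@le_trans _ _ (Ex (fun w => (c * p) `^ p * expR (c^-1 * Sy w)))).
    by apply: le_expect => // w; exact: powR_pos_le.
  rewrite expectZ.
  have -> : K0 * p = c * p * expR 6 by rewrite /K0; ring.
  rewrite [leRHS]powRM ?(ltW e0) //; last by rewrite mulr_ge0 ?(ltW p0).
  rewrite ler_wpM2l ?powR_ge0 // (le_trans exp_bd) // -expRM ler_expR.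
  by move: ESy; rewrite -/Sy; lra.
have HW : Ex (fun w => W w `^ p) <= (K0 * p) `^ p.
  apply: le_trans (expect_sum_powR_le mu_ge0 mu_sum1 p_ge1 exceed_ge0 sum_exceed sum_exceed_pow) _.
  by apply: ler_powR2r; rewrite ?ler_wpM2r ?mulr_ge0 //; lra.
have H2 : 2 `^ p <= (K0 * p) `^ p.
  apply: ler_powR2r => //; rewrite ?(ltW p0) //.
  have : K0 <= K0 * p by rewrite ler_peMr //; lra.
  by lra.
apply: (@le_trans _ _ (Ex (fun w => 3 `^ p *
   (Num.max (Sy w) 0 `^ p + W w `^ p + 2 `^ p)))).
  apply: le_expect => // w.
  apply: le_trans (powRD3_le (ltW p0) _ (W0 w) _) => //; last by rewrite le_max lexx orbT.
  apply: ler_powR2r; rewrite ?(ltW p0) ?le_max ?lexx ?orbT //.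
  rewrite ge_max; apply/andP; split.
    apply: le_trans (SSy w) _; rewrite !lerD2r le_max lexx //.
  by rewrite !addr_ge0 // le_max lexx orbT.
rewrite expectZ !expectD expect_cst //.
have -> : 9 * K0 * p = 3 * (3 * (K0 * p)) by ring.
have K3 : 0 <= 3 * (K0 * p) by exact: mulr_ge0.
rewrite [leRHS]powRM // ler_wpM2l ?powR_ge0 // [leRHS]powRM //.
have : 3 * (K0 * p) `^ p <= 3 `^ p * (K0 * p) `^ p.
  by rewrite ler_wpM2r ?powR_ge0 // le1r_powR //; lra.
by move: HS HW H2; lra.
Qed.

End Truncation.

Section FiniteMoment.
Context {R : realType} {T : finType} {n : nat} {F : finType}.
Implicit Types (i k : 'I_n) (w : {ffun 'I_n -> T}) (t : T) (f : F).
Variable mu : 'I_n -> T -> R.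
Hypothesis mu_ge0 : forall i t, 0 <= mu i t.
Hypothesis mu_sum1 : forall i, \sum_t mu i t = 1.
Local Notation Ex := (expect mu).

Lemma expect_norm_powR_le (x : F -> 'I_n -> T -> R) (M : {ffun 'I_n -> T} -> R)
    (p c : R) (fs : {ffun 'I_n -> T} -> F) :
  1 <= p -> 3552 <= c -> (forall f i w, `|x f i (w i)| <= M w) -> (forall w, 0 <= M w) ->
  Ex (fun w => M w `^ p) <= 1 ->
  (forall f i, \sum_t mu i t * x f i t = 0) ->
  (forall f, \sum_i \sum_t mu i t * x f i t ^+ 2 <= p) ->
  (forall f w, psum x f w <= psum x (fs w) w) ->
  Ex (fun w => psum x (fs w) w) <= p ->
  Ex (fun w => `|psum x (fs w) w| `^ p) <= (18 * (c * expR 6) * p) `^ p.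
Proof.
move=> p1 cge xM M0 Mp xc xv fm Sm.
have p0 : 0 < p by exact: lt_le_trans p1.
have c0 : 0 <= c := le_trans (ler0n _ _) cge.
have [w0|T0] := pickP (@predT {ffun 'I_n -> T}); last first.
  by rewrite /expect big_pred0 ?powR_ge0.
move=> _; set f0 := fs w0; set S := fun w => psum x (fs w) w.
have up := expect_pos_powR_le mu_ge0 mu_sum1 p1 xM M0 Mp xc xv cge fm Sm.
(* A class with the single member [- x f0]: its sum is centered and dominates [- S], so the
   one-sided bound covers the lower tail. *)
pose x' (_ : unit) i t := - x f0 i t.
have U' w : psum x' tt w = - psum x f0 w by rewrite /psum -sumrN.
have x'M (f : unit) i w : `|x' f i (w i)| <= M w by rewrite normrN.
have x'c (f : unit) i : \sum_t mu i t * x' f i t = 0.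
  transitivity (- \sum_t mu i t * x f0 i t); last by rewrite xc oppr0.
  by rewrite -sumrN; apply: eq_bigr => t _; rewrite mulrN.
have x'v (f : unit) : \sum_i \sum_t mu i t * x' f i t ^+ 2 <= p.
  apply: le_trans (xv f0); apply: ler_sum => i _; apply: ler_sum => t _.
  by rewrite sqrrN.
have x'm (f : unit) w : psum x' f w <= psum x' tt w by case: f.
have E' : Ex (psum x' tt) <= p.
  by rewrite (eq_expect mu U') expectN (expect_psum mu_sum1 xc) oppr0 ltW.
have down := expect_pos_powR_le mu_ge0 mu_sum1 p1 x'M M0 Mp x'c x'v cge
  (fs := fun=> tt) x'm E'.
set K := 9 * (c * expR 6) in up down.
have K0 : 0 <= K by rewrite !mulr_ge0 ?expR_ge0.
(* Two tails are added; as [p >= 1], the factor 2 can go inside the power. *)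
apply: (@le_trans _ _ (2 * (K * p) `^ p)).
  have -> : 2 * (K * p) `^ p = (K * p) `^ p + (K * p) `^ p by ring.
  apply: le_trans (lerD up down); rewrite -expectD; apply: le_expect => // w.
  have [S0|S0] := leP 0 (psum x (fs w) w).
    by rewrite ger0_norm // lerDl powR_ge0.
  rewrite ltr0_norm //; apply: (@le_trans _ _ (Num.max (psum x' tt w) 0 `^ p)).
    apply: ler_powR2r; rewrite ?(ltW p0) ?oppr_ge0 ?(ltW S0) //.
    by rewrite le_max U' lerN2 fm.
  by rewrite lerDr powR_ge0.
have -> : 18 * (c * expR 6) * p = 2 * (K * p) by rewrite /K; ring.
rewrite [leRHS]powRM ?mulr_ge0 ?(ltW p0) //.
by rewrite ler_wpM2r ?powR_ge0 // le1r_powR // ler1n.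
Qed.

End FiniteMoment.

Local Open Scope classical_set_scope.
Local Open Scope ring_scope.

(** * Reduction to finitely many values *)

Import HBNNSimple.

Section SimpleApproximation.
Context {R : realType} {d : measure_display} {T : measurableType d}.

Lemma nonneg_simple_approx (f : T -> R) :
  measurable_fun setT f -> (forall t, 0 <= f t) ->
  exists g : nat -> T -> R, [/\ forall n, measurable_fun setT (g n),
    forall n, exists s : seq R, forall t, g n t \in s,
    forall n t, 0 <= g n t <= f t &
    forall t, g n t @[n --> \oo] --> f t].
Proof.
move=> mf f0.
have mF : measurable_fun setT (EFin \o f : T -> \bar R) by exact/measurable_EFinP.
have F0 t : setT t -> (0 <= (EFin \o f) t)%E by rewrite lee_fin.
pose g n : T -> R := nnsfun_approx measurableT mF n.
have cv t : g n t @[n --> \oo] --> f t.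
  by have /fine_cvgP[] := cvg_nnsfun_approx measurableT mF F0 (I : setT t).
exists g; split => //.
- move=> n; have /finite_seqP[s sE] := fimfunP (nnsfun_approx measurableT mF n).
  exists s => t; have : range (g n) (g n t) by exists t.
  by rewrite [range _]sE.
- move=> n t; apply/andP; split; first by rewrite /g.
  rewrite -(cvg_lim (@Rhausdorff R) (cv t)); apply: nondecreasing_cvgn_le.
    by move=> a b ab; have /lefP/(_ t) := nd_nnsfun_approx measurableT mF ab.
  by apply/cvg_ex; exists (f t).
Qed.

(** Positive and negative parts are approximated from below, and at each point one of them vanishes
    together with its approximations. This gives the domination that dominated convergence will
    use. *)
Lemma simple_approx (f : T -> R) : measurable_fun setT f ->
  exists g : nat -> T -> R, [/\ forall n, measurable_fun setT (g n),
    forall n, exists s : seq R, forall t, g n t \in s,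
    forall n t, `|g n t| <= `|f t| &
    forall t, g n t @[n --> \oo] --> f t].
Proof.
move=> mf.
have [|t|u [mu su ul uf]] := @nonneg_simple_approx (fun t => Num.max (f t) 0).
- exact: measurable_maxr.
- by rewrite le_max lexx orbT.
have [|t|v [mv sv vl vf]] := @nonneg_simple_approx (fun t => Num.max (- f t) 0).
- by apply: measurable_maxr => //; exact: measurableT_comp.
- by rewrite le_max lexx orbT.
exists (fun n t => u n t - v n t); split.
- by move=> n; exact: measurable_funB.
- move=> n; have [s1 s1P] := su n; have [s2 s2P] := sv n.
  exists [seq a - b | a <- s1, b <- s2] => t.
  by apply: allpairs_f.
- move=> n t; have /andP[u0 uM] := ul n t; have /andP[v0 vM] := vl n t.
  have [ft|ft] := leP 0 (f t).
    move: vM uM; rewrite (max_r (_ : - f t <= 0)) ?oppr_le0 // (max_l ft) => vM uM.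
    have -> : v n t = 0 by apply/eqP; rewrite eq_le vM.
    by rewrite subr0 !ger0_norm.
  move: vM uM; rewrite (max_l (_ : 0 <= - f t)) ?oppr_ge0 ?(ltW ft) // (max_r (ltW ft)).
  move=> vM uM; have -> : u n t = 0 by apply/eqP; rewrite eq_le uM.
  by rewrite sub0r normrN (ltr0_norm ft) ger0_norm.
- move=> t; have -> : f t = Num.max (f t) 0 - Num.max (- f t) 0.
    by rewrite /Num.max; case: ifP; case: ifP; lra.
  exact: cvgB.
Qed.

End SimpleApproximation.

Section FiniteRange.
Context {R : realType} {d : measure_display} {Omega : measurableType d}.
Variable P : probability Omega R.
Local Open Scope ereal_scope.

Lemma integral_finite_range (L : finType) (h : Omega -> L) (Phi : L -> R) :
  (forall l, measurable (h @^-1` [set l])) ->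
  P.-integrable setT (fun w => (Phi (h w))%:E) /\
  \int[P]_w (Phi (h w))%:E = (\sum_l fine (P (h @^-1` [set l])) * Phi l)%R%:E.
Proof.
move=> mh.
have E : (fun w => (Phi (h w))%:E) =
    (fun w => \sum_l (Phi l)%:E * (\1_(h @^-1` [set l]) w)%:E).
  apply/funext => w; rewrite (bigD1 (h w)) //= big1 ?adde0.
    by rewrite indicE mem_set // mule1.
  move=> l lh; rewrite indicE memNset ?mule0 // => hl.
  by move: lh; rewrite -hl eqxx.
have I l : P.-integrable setT (fun w => (Phi l)%:E * (\1_(h @^-1` [set l]) w)%:E).
  by apply: integrableZl => //; exact: integrable_indic.
rewrite E; split; first by apply: integrable_sum.
rewrite integral_sum // -sumEFin; apply: eq_bigr => l _.
rewrite integralZl //; last exact: integrable_indic.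
rewrite integral_indic // setIT mulrC EFinM fineK //.
exact: fin_num_measure.
Qed.

End FiniteRange.

(** The label of [t] records, for each [j], the position of [g j t] in the list of values [s j]; a
    common bound on these positions makes the labels a finite type. *)
Lemma finite_labels (R : realType) (d : measure_display) (T : measurableType d)
    (J : finType) (g : J -> T -> R) :
  (forall j, measurable_fun setT (g j)) ->
  (forall j, exists s : seq R, forall t, g j t \in s) ->
  exists (L : finType) (lab : T -> L) (v : J -> L -> R),
    (forall l, measurable (lab @^-1` [set l])) /\
    (forall j t, v j (lab t) = g j t).
Proof.
move=> mg /choice[s sP].
pose lab t : {ffun J -> 'I_(\max_j size (s j)).+1} :=
  [ffun j => inord (index (g j t) (s j))].
pose v j (l : {ffun J -> 'I_(\max_j size (s j)).+1}) := (s j)`_(l j).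
have vlab j t : v j (lab t) = g j t.
  rewrite /v /lab ffunE inordK ?nth_index // ltnS.
  by apply: leq_trans (index_size _ _) (leq_bigmax j).
exists _, lab, v; split => // l.
case: (pselect (exists t, lab t = l)) => [[t0 <-]|N]; last first.
  rewrite (_ : _ @^-1` _ = set0); first exact: measurable0.
  by apply/seteqP; split => // t /= h; apply: N; exists t.
rewrite (_ : _ @^-1` _ = \bigcap_(j in [set: J]) (g j @^-1` [set g j t0])).
  apply: fin_bigcap_measurable => [|j _]; first exact: finite_finset.
  by rewrite -[X in measurable X]setTI; exact: mg.
apply/seteqP; split => t /= h.
  by move=> j _ /=; rewrite -!vlab h.
by apply/ffunP => j; rewrite !ffunE (h j I).
Qed.

(** * Discretization of independent variables *)

Section DiscreteLaw.
Context {R : realType} {d d' : measure_display}.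
Context {Omega : measurableType d} {T : measurableType d'}.
Variable P : probability Omega R.
Variables (n : nat) (Z : 'I_n -> {RV P >-> T}).
Hypothesis indep : mutually_independent Z.
Variables (L : finType) (lab : T -> L).
Hypothesis mlab : forall l, measurable (lab @^-1` [set l]).

Definition law i l : R := fine (P (Z i @^-1` (lab @^-1` [set l]))).
Definition labels (w : Omega) : {ffun 'I_n -> L} := [ffun i => lab (Z i w)].

Lemma law_ge0 i l : 0 <= law i l.
Proof. exact: fine_ge0. Qed.

Let mZ i l : measurable ((fun w => lab (Z i w)) @^-1` [set l]).
Proof. exact: (measurable_funPTI (Z i) (mlab l)). Qed.

Lemma integral_law i (Phi : L -> R) :
  P.-integrable setT (fun w => (Phi (lab (Z i w)))%:E) /\
  (\int[P]_w (Phi (lab (Z i w)))%:E = (\sum_l law i l * Phi l)%:E)%E.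
Proof. exact: (@integral_finite_range _ _ _ P _ (fun w => lab (Z i w))). Qed.

Lemma law_sum1 i : \sum_l law i l = 1.
Proof.
have [_] := integral_law i (fun=> 1).
have -> : (\int[P]_w 1%:E = 1%:E)%E.
  by rewrite integral_cst // mul1e; exact: probability_setT.
by case=> ->; apply: eq_bigr => l _; rewrite mulr1.
Qed.

(** Independence enters here, for the whole index set: the preimage of a tuple of labels is an
    intersection over all coordinates, so its probability is the product mass. *)
Lemma integral_labels (Phi : {ffun 'I_n -> L} -> R) :
  P.-integrable setT (fun w => (Phi (labels w))%:E) /\
  (\int[P]_w (Phi (labels w))%:E = (expect law Phi)%:E)%E.
Proof.
have E l : labels @^-1` [set l] =
    \bigcap_(i in [set` [set: 'I_n]%SET]) (Z i @^-1` (lab @^-1` [set l i])).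
  apply/seteqP; split => w /= h.
    by move=> i _ /=; rewrite -h ffunE.
  by apply/ffunP => i; rewrite ffunE; apply: h; rewrite /= inE.
have ml l : measurable (labels @^-1` [set l]).
  by rewrite E; apply: fin_bigcap_measurable => [|i _]; [exact: finite_finset | exact: mZ].
have [? ->] := @integral_finite_range _ _ _ P _ labels Phi ml; split => //.
congr (_ %:E); apply: eq_bigr => l _; congr (_ * _).
rewrite E indep; last by move=> i _; exact: mlab.
rewrite (eq_bigr (fun i => (law i (l i))%:E)) => [|i _]; last first.
  by rewrite /law fineK // fin_num_measure //; exact: mZ.
by rewrite prodEFin /= /pmass; apply: eq_bigl => i; rewrite inE.
Qed.

End DiscreteLaw.

Section SimpleClass.
Context {R : realType} {d d' : measure_display}.
Context {Omega : measurableType d} {T : measurableType d'}.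
Variable P : probability Omega R.
Variables (n : nat) (Z : 'I_n -> {RV P >-> T}).
Hypothesis indep : mutually_independent Z.
Variables (J : finType) (g : J -> T -> R) (cm : J -> 'I_n -> R) (p c : R).
Hypothesis g_meas : forall j, measurable_fun setT (g j).
Hypothesis g_range : forall j, exists s : seq R, forall t, g j t \in s.
Hypothesis p_ge1 : 1 <= p.
Hypothesis c_ge : 3552 <= c.
Hypothesis g_mean : forall j i, (\int[P]_w (g j (Z i w))%:E = (cm j i)%:E)%E.
Hypothesis g_var : forall j,
  (\sum_i \int[P]_w (g j (Z i w) ^+ 2)%:E <= p%:E)%E.
Variable B : Omega -> \bar R.
Hypothesis B_meas : measurable_fun setT B.
Hypothesis B_ge0 : forall w, (0 <= B w)%E.
Hypothesis B_ge : forall j i w, ((`|g j (Z i w) - cm j i| `^ p)%:E <= B w)%E.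
Hypothesis B_int : (\int[P]_w B w <= 1)%E.
Variables S H : Omega -> R.
Hypothesis S_ge : forall j w, \sum_i (g j (Z i w) - cm j i) <= S w.
Hypothesis S_attained : forall w, exists j, S w = \sum_i (g j (Z i w) - cm j i).
Hypothesis H_meas : measurable_fun setT H.
Hypothesis H_ge0 : forall w, 0 <= H w.
Hypothesis H_ge : forall w, S w <= H w.
Hypothesis H_int : (\int[P]_w (H w)%:E <= p%:E)%E.

(** Simple functions need not be centered, so their means [cm] are subtracted. Through the majorants
    [B] and [H], the moment conditions can be checked on the original class. *)
Lemma simple_class_moment : measurable_fun setT S /\
  (\int[P]_w (`|S w| `^ p)%:E <= ((18 * (c * expR 6) * p) `^ p)%:E)%E.
Proof.
have [L [lab [v [mlab vlab]]]] := finite_labels g_meas g_range.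
set mu := law Z lab.
have mu0 i l : 0 <= mu i l by exact: law_ge0.
have mu1 i : \sum_l mu i l = 1 by exact: law_sum1.
pose x j i l := v j l - cm j i.
have cmE j i : \sum_l mu i l * v j l = cm j i.
  have [_] := integral_law Z mlab i (v j).
  under eq_integral do rewrite vlab.
  by rewrite g_mean => -[].
have xc j i : \sum_l mu i l * x j i l = 0.
  under eq_bigr do rewrite mulrBr.
  by rewrite sumrB -mulr_suml mu1 mul1r cmE subrr.
have xv j : \sum_i \sum_l mu i l * x j i l ^+ 2 <= p.
  rewrite -lee_fin; apply: le_trans (g_var j).
  rewrite -sumEFin; apply: lee_sum => i _.
  have [_] := integral_law Z mlab i (fun l => v j l ^+ 2).
  under eq_integral do rewrite vlab.
  move=> ->; rewrite lee_fin -subr_ge0 -sumrB.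
  have -> : \sum_l (law Z lab i l * v j l ^+ 2 - mu i l * x j i l ^+ 2) =
     \sum_l (2 * cm j i * (mu i l * v j l) - mu i l * cm j i ^+ 2).
    by apply: eq_bigr => l _; rewrite -/mu /x; ring.
  rewrite sumrB -mulr_sumr cmE -mulr_suml mu1.
  have -> : 2 * cm j i * cm j i - 1 * cm j i ^+ 2 = cm j i ^+ 2 by ring.
  exact: sqr_ge0.
have psumE j w : psum x j (labels Z lab w) = \sum_i (g j (Z i w) - cm j i).
  by apply: eq_bigr => i _; rewrite ffunE /x vlab.
case: (pselect (exists w : Omega, True)) => [[w0 _]|N]; last first.
  have E0 : [set: Omega] = set0.
    by apply/seteqP; split => // w _; apply: N; exists w.
  by split; rewrite E0 ?integral_set0 ?lee_fin ?powR_ge0 //; exact: measurable_fun_set0.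
have [j0 _] := S_attained w0.
pose fs l := [arg max_(j > j0) psum x j l]%O.
have fs_max j l : psum x j l <= psum x (fs l) l.
  by rewrite /fs; case: arg_maxP => //= k _; exact.
have SE w : S w = psum x (fs (labels Z lab w)) (labels Z lab w).
  apply/eqP; rewrite eq_le; apply/andP; split.
    by have [j ->] := S_attained w; rewrite -psumE fs_max.
  by rewrite psumE S_ge.
pose M (l : {ffun 'I_n -> L}) := \big[Num.max/0]_j \big[Num.max/0]_i `|x j i (l i)|.
have M0 (l : {ffun 'I_n -> L}) : 0 <= M l by exact: bigmax_ge_id.
have xM (j : J) (i : 'I_n) (l : {ffun 'I_n -> L}) : `|x j i (l i)| <= M l.
  apply: le_trans (le_bigmax 0 (fun j => \big[Num.max/0]_i `|x j i (l i)|) j).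
  exact: (le_bigmax 0 (fun i => `|x j i (l i)|) i).
have p0 : 0 < p by exact: lt_le_trans p_ge1.
have ML (Phi : {ffun 'I_n -> L} -> R) := integral_labels indep mlab Phi.
have mL (Phi : {ffun 'I_n -> L} -> R) :
    measurable_fun setT (fun w => (Phi (labels Z lab w))%:E).
  by have [/integrableP[]] := ML Phi.
have Mp : expect mu (fun l => M l `^ p) <= 1.
  have [_ E] := ML (fun l => M l `^ p).
  rewrite -lee_fin -/mu -E; apply: le_trans B_int.
  apply: ge0_le_integral => //.
  - by move=> w _; rewrite lee_fin powR_ge0.
  - exact: (mL (fun l => M l `^ p)).
  move=> w _; rewrite /M.
  have mx (a b : R) : ((a `^ p)%:E <= B w)%E -> ((b `^ p)%:E <= B w)%E ->
      (((Num.max a b) `^ p)%:E <= B w)%E.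
    by rewrite /Num.max; case: ifP.
  apply: (big_ind (fun a => ((a `^ p)%:E <= B w)%E)) => [|//|j _]; first by rewrite powR0 ?gt_eqF.
  apply: (big_ind (fun a => ((a `^ p)%:E <= B w)%E)) => [|//|i _]; first by rewrite powR0 ?gt_eqF.
  by rewrite ffunE /x vlab.
have Sm : expect mu (fun l => psum x (fs l) l) <= p.
  (* The positive part makes the integrand nonnegative for the comparison of integrals, and stays
     below [H]. *)
  apply: (@le_trans _ _ (expect mu (fun l => Num.max (psum x (fs l) l) 0))).
    by apply: le_expect => // l; rewrite le_max lexx.
  have [_ E] := ML (fun l => Num.max (psum x (fs l) l) 0).
  rewrite -lee_fin -/mu -E; apply: le_trans H_int.
  apply: ge0_le_integral => //.
  - by move=> w _; rewrite lee_fin le_max lexx orbT.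
  - exact: (mL (fun l => Num.max (psum x (fs l) l) 0)).
  - exact/measurable_EFinP.
  - by move=> w _; rewrite -SE lee_fin ge_max H_ge H_ge0.
have := expect_norm_powR_le mu0 mu1 p_ge1 c_ge xM M0 Mp xc xv fs_max Sm.
split.
  apply/measurable_EFinP.
  rewrite (_ : _ \o _ = (fun w => (psum x (fs (labels Z lab w)) (labels Z lab w))%:E)).
    exact: (mL (fun l => psum x (fs l) l)).
  by apply/funext => w; rewrite /= SE.
under eq_integral do rewrite SE.
by have [_ ->] := ML (fun l => `|psum x (fs l) l| `^ p); rewrite lee_fin.
Qed.

End SimpleClass.

(** * Passage to the limit *)

Section Fatou.
Context {R : realType}.

Lemma lee_of_lt_real (a b : \bar R) :
  (0 <= a)%E -> (forall r : R, (r%:E < a)%E -> (r%:E <= b)%E) -> (a <= b)%E.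
Proof.
move=> a0 ab; rewrite leNgt; apply/negP => ba.
have : (-oo < b)%E.
  by apply: lt_le_trans (ab (-1) _); rewrite ?ltNyr // (lt_le_trans _ a0) // lte_fin; lra.
move: ba ab; case: b => [b| |] // ba ab _.
  have [a_fin|] := boolP (a \is a fin_num).
    move: ba ab; rewrite -(fineK a_fin) lte_fin => ba /(_ ((b + fine a) / 2)).
    rewrite lte_fin lee_fin => h.
    have : (b + fine a) / 2 <= b by apply: h; lra.
    by lra.
  rewrite ge0_fin_numE // -leNgt leye_eq => /eqP aoo.
  move: (ab (b + 1)); rewrite aoo ltry lee_fin => /(_ isT).
  by rewrite gerDl ler10.
by move: ba; rewrite ltNge leey.
Qed.

(** Fatou's lemma through lower bounds: every real number below [h w] lies eventually below [g n w],
    hence below the lower limit. This covers infinite values of [h]. *)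
Lemma fatou_lsc (d : measure_display) (T : measurableType d)
    (mu : {measure set T -> \bar R}) (h : T -> \bar R) (g : nat -> T -> \bar R)
    (C : \bar R) :
  measurable_fun setT h -> (forall w, (0 <= h w)%E) ->
  (forall n, measurable_fun setT (g n)) -> (forall n w, (0 <= g n w)%E) ->
  (forall w (r : R), (r%:E < h w)%E -> \forall n \near \oo, (r%:E <= g n w)%E) ->
  (\forall n \near \oo, (\int[mu]_w g n w <= C)%E) ->
  (\int[mu]_w h w <= C)%E.
Proof.
move=> mh h0 mg g0 hg gC.
have ninfE (u : (\bar R)^nat) : limn_einf u = ereal_sup (range (einfs u)).
  by rewrite limn_einf_lim; apply: cvg_lim => //; exact: cvg_einfs_sup.
have mninf : measurable_fun setT (fun w => limn_einf (g ^~ w)).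
  rewrite (_ : (fun w => _) = (fun w => - limn_esup ((fun n w => - g n w) ^~ w))%E).
    apply: measurableT_comp => //; apply: measurable_fun_limn_esup => n.
    exact: measurableT_comp.
  apply/funext => w; rewrite -limn_einfN; congr limn_einf.
  by apply/funext => n; rewrite /= oppeK.
apply: (@le_trans _ _ (\int[mu]_w limn_einf (g ^~ w))%E).
  apply: ge0_le_integral => // w _; apply: lee_of_lt_real => // r /hg[N _ Ng].
  rewrite ninfE; apply: (@le_trans _ _ (einfs (g ^~ w) N)).
    by apply: le_ereal_inf_tmp => _ [k /= Nk <-]; exact: Ng.
  by apply: ereal_sup_ubound; exists N.
apply: le_trans (fatou mu measurableT mg (fun n w _ => g0 n w)) _.
rewrite ninfE; apply: ge_ereal_sup => _ [N _ <-].
have [N' _ NC] := gC.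
apply: le_trans (NC (maxn N N') (leq_maxr _ _)).
by apply: ereal_inf_lbound; exists (maxn N N') => //=; exact: leq_maxl.
Qed.

(** For [r >= 0], taking roots reduces the claim to the convergence of [u]; a negative [r] lies
    below every power. *)
Lemma near_powR_ge (u : nat -> R) (a r p : R) : 0 < p -> (forall n, 0 <= u n) ->
  u n @[n --> \oo] --> a -> r < a `^ p -> \forall n \near \oo, r <= u n `^ p.
Proof.
move=> p0 u0 ua ra; have [r0|r0] := ltP r 0.
  by near=> n; apply: le_trans (ltW r0) (powR_ge0 _ _).
have a0 : 0 <= a by apply: (cvgr_to_ge ua); exact: nearW.
have rp : (r `^ p^-1) `^ p = r by rewrite -powRrM mulVf ?lt0r_neq0 // powRr1.
have ba : r `^ p^-1 < a.
  rewrite ltNge; apply/negP => ab; move: ra; rewrite ltNge -rp => /negP; apply.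
  by apply: ler_powR2r => //; exact: ltW.
near=> n; rewrite -rp; apply: ler_powR2r; [exact: ltW|exact: powR_ge0|].
by near: n; exact: (cvgr_ge _ ua _ ba).
Unshelve. all: by end_near. Qed.

End Fatou.

Lemma powRD2_le (R : realType) (a b p : R) : 0 <= p -> 0 <= a -> 0 <= b ->
  (a + b) `^ p <= 2 `^ p * (a `^ p + b `^ p).
Proof.
move=> p0 a0 b0; set m := Num.max a b.
have m0 : 0 <= m by rewrite le_max a0.
apply: (@le_trans _ _ ((2 * m) `^ p)).
  apply: ler_powR2r => //; first exact: addr_ge0.
  have : a <= m by rewrite le_max lexx.
  have : b <= m by rewrite le_max lexx orbT.
  by clearbody m; lra.
rewrite powRM // ler_wpM2l ?powR_ge0 //.
rewrite /m /Num.max; case: ifP => _; first by rewrite lerDr powR_ge0.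
by rewrite lerDl powR_ge0.
Qed.

Lemma cvg_sum0 (R : realType) (I : Type) (r : seq I) (u : I -> nat -> R) :
  (forall i, u i n @[n --> \oo] --> (0 : R)) ->
  (\sum_(i <- r) u i n) @[n --> \oo] --> (0 : R).
Proof.
move=> u0; elim: r => [|i r IH].
  by under eq_fun do rewrite big_nil; exact: cvg_cst.
under eq_fun do rewrite big_cons.
have h := cvgD (u0 i) IH; rewrite addr0 in h; exact: h.
Qed.

Lemma dominated_mean (R : realType) (d : measure_display) (Omega : measurableType d)
    (P : probability Omega R) (X : Omega -> R) (G : nat -> Omega -> R) :
  P.-integrable setT (EFin \o X) -> (forall n, measurable_fun setT (G n)) ->
  (forall n w, `|G n w| <= `|X w|) -> (forall w, G n w @[n --> \oo] --> X w) ->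
  [/\ forall n, P.-integrable setT (EFin \o G n),
      fine (\int[P]_w (G n w)%:E) @[n --> \oo] --> fine (\int[P]_w (X w)%:E),
      fine (\int[P]_w (`|G n w - X w|)%:E) @[n --> \oo] --> (0 : R) &
      forall n, P.-integrable setT (EFin \o (fun w => `|G n w - X w|))].
Proof.
move=> iX mG GX cG.
have iG n : P.-integrable setT (EFin \o G n).
  apply: le_integrable iX => //; first exact/measurable_EFinP.
  by move=> w _; rewrite /= lee_fin.
have iD n : P.-integrable setT (EFin \o (fun w => `|G n w - X w|)).
  apply: (@integrable_norm _ _ _ _ _ (fun w => G n w - X w)).
  exact: (integrableB measurableT (iG n) iX).
have mGE n : measurable_fun setT (EFin \o G n) by exact/measurable_EFinP.
have cvE : {ae P, forall w, setT w -> (EFin \o G n) w @[n --> \oo] --> (EFin \o X) w}.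
  by apply: aeW => w _; apply: cvg_EFin; [exact: nearW | exact: cG].
have leE : {ae P, forall w n, setT w -> (`|(EFin \o G n) w| <= (abse \o (EFin \o X)) w)%E}.
  by apply: aeW => w n _; rewrite /= lee_fin.
have [_ lim_abs lim] := dominated_convergence measurableT mGE
  (measurable_int _ iX) cvE (integrable_abse iX) leE.
split => //.
- apply: fine_cvg; rewrite fineK; first exact: lim.
  exact: (integrable_fin_num measurableT iX).
- by apply: fine_cvg; exact: lim_abs.
Qed.

(** * Finite classes of measurable functions *)

Section FiniteClass.
Context {R : realType} {d d' : measure_display}.
Context {Omega : measurableType d} {T : measurableType d'}.
Variable P : probability Omega R.
Variables (n : nat) (Z : 'I_n -> {RV P >-> T}).
Hypothesis indep : mutually_independent Z.
Variables (J : finType) (f : J -> {mfun T >-> R}) (p c D : R).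
Hypothesis p_ge1 : 1 <= p.
Hypothesis c_ge : 3552 <= c.
Hypothesis D_gt0 : 0 < D.
Hypothesis f_int : forall j i, P.-integrable setT (fun w => (f j (Z i w))%:E).
Hypothesis f_mean : forall j i, (\int[P]_w (f j (Z i w))%:E = 0)%E.
Hypothesis f_var : forall j,
  (\sum_i \int[P]_w (f j (Z i w) ^+ 2)%:E <= (D ^+ 2 / p)%:E)%E.
Variable B : Omega -> \bar R.
Hypothesis B_meas : measurable_fun setT B.
Hypothesis B_ge0 : forall w, (0 <= B w)%E.
Hypothesis B_ge : forall j i w, ((`|f j (Z i w)| `^ p)%:E <= B w)%E.
Hypothesis B_int : (\int[P]_w B w <= ((D / p) `^ p)%:E)%E.
Variable S : Omega -> R.
Hypothesis S_meas : measurable_fun setT S.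
Hypothesis S_ge : forall j w, \sum_i f j (Z i w) <= S w.
Hypothesis S_attained : forall w, exists j, S w = \sum_i f j (Z i w).
Hypothesis S_int : (\int[P]_w (Num.max (S w) 0)%:E <= D%:E)%E.

(** After this scaling, the positive part of [S] has mean at most [p / 4], the variances are at most
    [p / 16], and the integral of the scaled [B] is at most 1/4 to the power [p]. The margins take
    up the errors of approximation. *)
Let lam := p / (4 * D).

Let p_gt0 : 0 < p. Proof. exact: lt_le_trans p_ge1. Qed.
Let lam_gt0 : 0 < lam. Proof. by rewrite divr_gt0 // mulr_gt0. Qed.
Let lamD : lam * D = p / 4. Proof. by rewrite /lam; field; rewrite lt0r_neq0. Qed.
Let lamDp : lam * (D / p) = 4^-1.
Proof. by rewrite mulrA lamD; field; rewrite lt0r_neq0. Qed.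

(** By [powRD2_le], this dominates the power [p] of a scaled value plus 1/4, where 1/4 bounds the
    scaled mean that recentering subtracts. Its integral is at most twice the power [p] of 1/2. *)
Let B' w : \bar R :=
  ((2 `^ p)%:E * ((lam `^ p)%:E * B w + (4^-1 `^ p)%:E))%E.

Let B'_int : (\int[P]_w B' w <= 1)%E.
Proof.
have h0 w : (0 <= (lam `^ p)%:E * B w)%E by rewrite mule_ge0 // lee_fin powR_ge0.
have mh : measurable_fun setT (fun w => (lam `^ p)%:E * B w)%E.
  exact: measurable_funeM.
have c0 : (0 <= (4^-1 `^ p)%:E :> \bar R)%E by rewrite lee_fin powR_ge0.
rewrite (@ge0_integralZl_EFin _ _ _ P _ measurableT
   (fun w => (lam `^ p)%:E * B w + (4^-1 `^ p)%:E)%E); first last.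
- exact: powR_ge0.
- exact: emeasurable_funD.
- by move=> w _; exact: adde_ge0.
rewrite (ge0_integralD P measurableT (fun w _ => h0 w) mh) //.
rewrite (@ge0_integralZl_EFin _ _ _ P _ measurableT B) ?powR_ge0 // integral_cst //.
rewrite [X in (_ * (_ + _ * X))%E](_ : _ = 1%E); last exact: probability_setT.
rewrite mule1.
apply: (@le_trans _ _ ((2 `^ p)%:E * ((lam `^ p)%:E * ((D / p) `^ p)%:E + (4^-1 `^ p)%:E))%E).
  by rewrite lee_wpmul2l ?lee_fin ?powR_ge0 // leeD2r // lee_wpmul2l ?lee_fin ?powR_ge0.
rewrite -EFinM lee_fin -powRM ?(ltW lam_gt0) ?divr_ge0 ?(ltW D_gt0) ?(ltW p_gt0) //.
rewrite lamDp -mulr2n mulrnAr -powRM //.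
have -> : 2 * 4^-1 = 2^-1 :> R by lra.
have : 2^-1 `^ p <= 2^-1 `^ 1 :> R by apply: ger_powR => //; lra.
rewrite powRr1 // mulr2n => h; apply: le_trans (lerD h h) _.
by have -> : 2^-1 + 2^-1 = 1 :> R by lra.
Qed.

Lemma finite_class_moment :
  (\int[P]_w (`|S w| `^ p)%:E <= ((72 * (c * expR 6) * D) `^ p)%:E)%E.
Proof.
have /choice[g gP] j := simple_approx (measurable_funPT (f j)).
pose X (q : J * 'I_n) w := f q.1 (Z q.2 w).
pose G (q : J * 'I_n) k w := g q.1 k (Z q.2 w).
have mG q k : measurable_fun setT (G q k).
  by have [mg _ _ _] := gP q.1; apply: measurableT_comp (mg k) _.
have mX q : measurable_fun setT (X q) by exact: measurableT_comp.
have GX q k w : `|G q k w| <= `|X q w| by have [_ _ gl _] := gP q.1; exact: gl.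
have cG q w : G q k w @[k --> \oo] --> X q w by have [_ _ _ gc] := gP q.1; exact: gc.
have dm q := dominated_mean (f_int q.1 q.2) (mG q) (GX q) (cG q).
pose cm k q := fine (\int[P]_w (G q k w)%:E).
pose delta k q := fine (\int[P]_w (`|G q k w - X q w|)%:E).
have cm0 q : cm k q @[k --> \oo] --> (0 : R).
  by have [_ + _ _] := dm q; rewrite f_mean.
have ncm0 q : `|cm k q| @[k --> \oo] --> (0 : R).
  by have h := cvg_norm (cm0 q); rewrite normr0 in h; exact: h.
pose eta k := \sum_q (delta k q + `|cm k q|).
have eta0 : eta k @[k --> \oo] --> (0 : R).
  apply: cvg_sum0 => q; have [_ _ d0 _] := dm q.
  by have h := cvgD d0 (ncm0 q); rewrite addr0 in h; exact: h.
(* One error for the whole class: it bounds the change of the sum for every [j], hence that of the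
   maximum, and its mean is [eta k]. *)
pose err k w := \sum_q (`|G q k w - X q w| + `|cm k q|).
have err0 w : err k w @[k --> \oo] --> (0 : R).
  apply: cvg_sum0 => q.
  have h1 : G q k w - X q w @[k --> \oo] --> (0 : R).
    have h := cvgB (cG q w) (cvg_cst (X q w)).
    by rewrite subrr in h; exact: h.
  have h := cvgD (cvg_norm h1) (ncm0 q).
  by rewrite normr0 addr0 in h; exact: h.
have err_ge0 k w : 0 <= err k w by apply: sumr_ge0 => q _; exact: addr_ge0.
have m_err k : measurable_fun setT (err k).
  apply: measurable_sum => q; apply: measurable_funD => //.
  by apply: measurableT_comp => //; exact: measurable_funB.
have err_int k : (\int[P]_w (err k w)%:E = (eta k)%:E)%E.
  under eq_integral do rewrite /err -sumEFin.
  rewrite integral_sum //; last first.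
    move=> q; have [_ _ _ iD] := dm q.
    exact: (integrableD measurableT (iD k) (finite_measure_integrable_cst P `|cm k q| measurableT)).
  rewrite -sumEFin; apply: eq_bigr => q _; have [_ _ _ iD] := dm q.
  under eq_integral do rewrite EFinD.
  rewrite (integralD measurableT (iD k) (finite_measure_integrable_cst P `|cm k q| measurableT)).
  rewrite EFinD fineK ?(integrable_fin_num measurableT (iD k)) //; congr (_ + _)%E.
  transitivity (\int[P]_w cst (`|cm k q|%:E) w)%E; first by [].
  by rewrite integral_cst // -[RHS]mule1; congr (_ * _)%E; exact: probability_setT.
case: (pselect (exists w : Omega, True)) => [[w0 _]|N]; last first.
  have E0 : [set: Omega] = set0.
    by apply/seteqP; split => // w _; apply: N; exists w.
  by rewrite E0 integral_set0 lee_fin powR_ge0.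
have [j0 _] := S_attained w0.
pose U k j w := \sum_i (g j k (Z i w) - cm k (j, i)).
have U_close k j w : `|U k j w - \sum_i f j (Z i w)| <= err k w.
  rewrite /U -sumrB; apply: le_trans (ler_norm_sum _ _ _) _.
  pose h q := `|G q k w - X q w| + `|cm k q|.
  apply: (@le_trans _ _ (\sum_i h (j, i))).
    apply: ler_sum => i _; rewrite /h /G /X /= addrAC.
    by apply: le_trans (ler_normB _ _) _.
  rewrite /err -/h -(pair_bigA _ (fun j i => h (j, i))) /= (bigD1 j) //= lerDl.
  by apply: sumr_ge0 => j' _; apply: sumr_ge0 => i _; exact: addr_ge0.
pose js k w := [arg max_(j > j0) U k j w]%O.
have js_max k j w : U k j w <= U k (js k w) w.
  by rewrite /js; case: arg_maxP => //= j' _; exact.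
pose Sk k w := U k (js k w) w.
have Sk_close k w : `|Sk k w - S w| <= err k w.
  rewrite ler_norml; apply/andP; split.
    have [j ->] := S_attained w; have := U_close k j w.
    rewrite ler_norml => /andP[+ _]; have := js_max k j w; rewrite /Sk; lra.
  have := U_close k (js k w) w; rewrite ler_norml => /andP[_].
  by have := S_ge (js k w) w; rewrite /Sk; lra.
have Sk_cvg w : `|Sk k w| @[k --> \oo] --> `|S w|.
  apply: cvg_norm; apply/cvgrPdist_le => e e0.
  have /cvgrPdist_le/(_ e e0) := err0 w.
  apply: filterS => k; rewrite sub0r normrN ger0_norm // => h.
  by rewrite distrC (le_trans (Sk_close k w)).
have eta_ge k q : `|cm k q| <= eta k.
  rewrite /eta (bigD1 q) //= -[leLHS]add0r -addrA lerD //.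
    by apply: fine_ge0; exact: integral_ge0.
  rewrite lerDl; apply: sumr_ge0 => q' _; rewrite addr_ge0 //.
  by apply: fine_ge0; exact: integral_ge0.
(* As [eta k] bounds all the means, this condition justifies the 1/4 in [B']; it also keeps the mean
   of the majorant of the scaled maximum below [p / 4 + 1/4 <= p]. *)
have good k : lam * eta k <= 4^-1 -> measurable_fun setT (fun w => lam * Sk k w) /\
    (\int[P]_w (`|lam * Sk k w| `^ p)%:E <= ((18 * (c * expR 6) * p) `^ p)%:E)%E.
  move=> ek; have lam0 := ltW lam_gt0.
  have gE j i w : lam * g j k (Z i w) - lam * cm k (j, i) =
     lam * (g j k (Z i w) - cm k (j, i)) by rewrite mulrBr.
  apply: (@simple_class_moment _ _ _ _ _ P n Z indep J (fun j t => lam * g j k t)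
    (fun j i => lam * cm k (j, i)) p c _ _ p_ge1 c_ge _ _ B' _ _ _ B'_int
    (fun w => lam * Sk k w) (fun w => lam * (Num.max (S w) 0 + err k w))).
  - by move=> j; have [mg _ _ _] := gP j; exact: measurable_funM.
  - move=> j; have [_ /(_ k)[s sP] _ _] := gP j.
    by exists [seq lam * y | y <- s] => t; apply: map_f.
  - move=> j i; have [/(_ k) iG _ _ _] := dm (j, i).
    under eq_integral do rewrite EFinM.
    have cmE : (cm k (j, i))%:E = (\int[P]_w (G (j, i) k w)%:E)%E.
      by rewrite /cm fineK // (integrable_fin_num measurableT iG).
    by rewrite (integralZl measurableT iG) [RHS]EFinM cmE.
  - move=> j.
    apply: (@le_trans _ _ ((lam ^+ 2)%:E * (D ^+ 2 / p)%:E)%E); last first.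
      rewrite -EFinM lee_fin mulrA -exprMn lamD.
      have -> : (p / 4) ^+ 2 / p = p / 16 by field; rewrite lt0r_neq0.
      by move: p_gt0; lra.
    apply: (@le_trans _ _ ((lam ^+ 2)%:E * \sum_i \int[P]_w (f j (Z i w) ^+ 2)%:E)%E); last first.
      by rewrite lee_wpmul2l // lee_fin sqr_ge0.
    rewrite ge0_sume_distrr; last first.
      by move=> i _; apply: integral_ge0 => w _; rewrite lee_fin sqr_ge0.
    apply: lee_sum => i _.
    have mf2 : measurable_fun setT (fun w => (f j (Z i w) ^+ 2)%:E).
      by apply/measurable_EFinP/measurable_funX; exact: (mX (j, i)).
    rewrite -ge0_integralZl_EFin ?sqr_ge0 //; last first.
      by move=> w _; rewrite lee_fin sqr_ge0.
    apply: ge0_le_integral => //.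
    + by move=> w _; rewrite lee_fin sqr_ge0.
    + apply/measurable_EFinP/measurable_funX/measurable_funM => //.
      exact: (mG (j, i)).
    + exact: measurable_funeM.
    + move=> w _; rewrite -EFinM lee_fin exprMn ler_wpM2l ?sqr_ge0 //.
      by rewrite -[leLHS]real_normK ?num_real // -[leRHS]real_normK ?num_real //
        lerXn2r ?nnegrE //; exact: (GX (j, i)).
  - apply: measurable_funeM; apply: emeasurable_funD => //.
    exact: measurable_funeM.
  - move=> w; rewrite mule_ge0 ?lee_fin ?powR_ge0 //.
    by rewrite adde_ge0 ?lee_fin ?powR_ge0 // mule_ge0 // lee_fin powR_ge0.
  - move=> j i w; rewrite gE.
    apply: (@le_trans _ _ (2 `^ p * ((lam * `|f j (Z i w)|) `^ p + 4^-1 `^ p))%:E).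
      rewrite lee_fin; apply: le_trans (powRD2_le (ltW p_gt0) _ _) => //.
        apply: ler_powR2r; rewrite ?(ltW p_gt0) //.
        rewrite normrM (gtr0_norm lam_gt0); apply: (@le_trans _ _ (lam * (`|f j (Z i w)| + eta k))).
          rewrite ler_wpM2l //; apply: le_trans (ler_normB _ _) _.
          by apply: lerD; [exact: (GX (j, i)) | exact: eta_ge].
        by rewrite mulrDr lerD2l.
      exact: mulr_ge0.
    rewrite /B' EFinM lee_wpmul2l ?lee_fin ?powR_ge0 // EFinD leeD2r //.
    by rewrite powRM // EFinM lee_wpmul2l ?lee_fin ?powR_ge0.
  - move=> j w; rewrite (eq_bigr _ (fun i _ => gE j i w)) -mulr_sumr ler_wpM2l //.
    exact: js_max.
  - move=> w; exists (js k w).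
    by rewrite (eq_bigr _ (fun i _ => gE (js k w) i w)) -mulr_sumr.
  - apply: measurable_funM => //; apply: measurable_funD => //.
    exact: measurable_maxr.
  - by move=> w; rewrite mulr_ge0 // addr_ge0 // le_max lexx orbT.
  - move=> w; rewrite ler_wpM2l //.
    have := Sk_close k w; rewrite ler_norml => /andP[_].
    have : S w <= Num.max (S w) 0 by rewrite le_max lexx.
    by move: (Num.max _ _) => y; lra.
  have mS0 : measurable_fun setT (fun w => (Num.max (S w) 0)%:E).
    by apply/measurable_EFinP; exact: measurable_maxr.
  have S0 w : (0 <= (Num.max (S w) 0)%:E)%E by rewrite lee_fin le_max lexx orbT.
  have me : measurable_fun setT (fun w => (err k w)%:E) by exact/measurable_EFinP.
  under eq_integral do rewrite EFinM EFinD.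
  rewrite ge0_integralZl_EFin //; first last.
    exact: emeasurable_funD.
    by move=> w _; rewrite adde_ge0 // lee_fin.
  rewrite ge0_integralD //; last by move=> w _; rewrite lee_fin.
  rewrite err_int; apply: (@le_trans _ _ (lam%:E * (D%:E + (eta k)%:E))%E).
    by rewrite lee_wpmul2l ?lee_fin // leeD2r.
  by rewrite -EFinD -EFinM lee_fin mulrDr lamD; move: ek p_ge1; lra.
have [N _ HN] : \forall k \near \oo, lam * eta k <= 4^-1.
  have : 0 < (4 * lam)^-1 by rewrite invr_gt0 mulr_gt0.
  move=> /(cvgr_le _ eta0); apply: filterS => k h.
  apply: le_trans (ler_wpM2l (ltW lam_gt0) h) _.
  by rewrite le_eqVlt; apply/orP; left; apply/eqP; field; rewrite lt0r_neq0.
(* The shift by [N] makes every term measurable, as Fatou's lemma demands. *)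
have goodN k := good (k + N)%N (HN _ (leq_addl _ _)).
have mSk k : measurable_fun setT (Sk (k + N)%N).
  have [ml _] := goodN k.
  rewrite (_ : Sk _ = (fun w => lam^-1 * (lam * Sk (k + N)%N w))).
    exact: measurable_funM.
  by apply/funext => w; rewrite mulKf // lt0r_neq0.
have mpow (V : Omega -> R) : measurable_fun setT V ->
    measurable_fun setT (fun w => (`|V w| `^ p)%:E).
  move=> mV; apply/measurable_EFinP.
  by apply: (measurableT_comp (measurable_powR p)); exact: measurableT_comp.
apply: (fatou_lsc (mpow _ S_meas) _ (fun k => mpow _ (mSk k))).
- by move=> w; rewrite lee_fin powR_ge0.
- by move=> k w; rewrite lee_fin powR_ge0.
- move=> w r; rewrite lte_fin => rS.
  have := near_powR_ge (u := fun k => `|Sk (k + N)%N w|) p_gt0 _ _ rS.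
  by apply => //; rewrite (cvg_shiftn N (fun k => `|Sk k w|)); exact: Sk_cvg.
apply: nearW => k; have [ml Ik] := goodN k.
have lamV : 0 <= lam^-1 by rewrite invr_ge0 ltW.
rewrite (_ : (fun w => _) =
    (fun w => (lam^-1 `^ p)%:E * (`|lam * Sk (k + N)%N w| `^ p)%:E)%E); last first.
  apply/funext => w; rewrite -EFinM -powRM // -{1}(ger0_norm lamV) -normrM mulKf //.
  exact: lt0r_neq0.
rewrite (@ge0_integralZl_EFin _ _ _ P _ measurableT
  (fun w => (`|lam * Sk (k + N)%N w| `^ p)%:E)); first last.
- exact: powR_ge0.
- exact: (mpow _ ml).
- by move=> w _; rewrite lee_fin powR_ge0.
(* Undoing the scaling: [p / lam = 4 * D] and [18 * 4 = 72]. *)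
apply: (@le_trans _ _ ((lam^-1 `^ p)%:E * ((18 * (c * expR 6) * p) `^ p)%:E)%E).
  by rewrite lee_wpmul2l // lee_fin powR_ge0.
have c0 : 0 <= c := le_trans (ler0n _ _) c_ge.
rewrite -EFinM -powRM ?mulr_ge0 ?expR_ge0 ?(ltW p_gt0) //.
rewrite le_eqVlt; apply/orP; left; apply/eqP; congr (_ `^ _)%:E.
by rewrite /lam; field; rewrite !lt0r_neq0.
Qed.

End FiniteClass.

(** The enumeration inverts an injection into the natural numbers; the indices missed by the
    injection are sent to a fixed element of [F]. *)
Lemma countable_enumeration (X : Type) (F : set X) :
  countable F -> F !=set0 -> exists e : nat -> X, F = range e.
Proof.
move=> /countable_injP[phi phi_inj] [f0 Ff0].
have /choice[e eP] k : exists x, F x /\ ((exists y, F y /\ phi y = k) -> phi x = k).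
  case: (pselect (exists y, F y /\ phi y = k)) => [[y [Fy yk]]|N].
    by exists y.
  by exists f0; split => // h; case: N.
exists e; apply/seteqP; split => [x Fx|_ [k _ <-]]; last by have [] := eP k.
exists (phi x) => //; have [Fe ephi] := eP (phi x).
by apply: phi_inj; rewrite ?inE //; apply: ephi; exists x.
Qed.

Lemma measurable_ereal_sup_range (R : realType) (d : measure_display)
    (Omega : measurableType d) (u : nat -> Omega -> \bar R) :
  (forall k, measurable_fun setT (u k)) ->
  measurable_fun setT (fun w => ereal_sup (range (u ^~ w))).
Proof.
move=> mu; have := measurable_fun_esups mu 0%N.
rewrite (_ : (fun w => esups _ _) = (fun w => ereal_sup (range (u ^~ w)))) //.
apply/funext => w; congr ereal_sup; apply/seteqP.
by split => x [k _ <-]; exists k.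
Qed.

(** * Countable classes as limits of finite ones *)

Section CountableClass.
Context {R : realType} {d d' : measure_display}.
Context {Omega : measurableType d} {T : measurableType d'}.
Variable P : probability Omega R.
Variables (n : nat) (Z : 'I_n -> {RV P >-> T}).
Hypothesis indep : mutually_independent Z.
Variable e : nat -> {mfun T >-> R}.
Let F := range e.
Variables (p c D : R).
Hypothesis p_ge1 : 1 <= p.
Hypothesis c_ge : 3552 <= c.
Hypothesis D_gt0 : 0 < D.
Hypothesis f_sqr : forall k i, ('E_P[(fun w => (e k (Z i w) ^+ 2)%R)] < +oo)%E.
Hypothesis f_mean : forall k i, ('E_P[(fun w => e k (Z i w))] = 0)%E.
Hypothesis S_int : (\int[P]_w `|sup_sum Z F w| <= D%:E)%E.
Hypothesis f_var : (weak_variance Z F <= (D ^+ 2 / p)%:E)%E.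
Hypothesis B_int : (\int[P]_w max_sup_pow Z F p w <= ((D / p) `^ p)%:E)%E.

Let p_gt0 : 0 < p. Proof. exact: lt_le_trans p_ge1. Qed.

Let U k w := \sum_i e k (Z i w).

(** It starts from the first sum and not from a base value such as 0, because the supremum may be
    negative. *)
Fixpoint partial_max m w :=
  if m is m'.+1 then Num.max (partial_max m' w) (U m'.+1 w) else U 0%N w.

Let me k i : measurable_fun setT (fun w => e k (Z i w)).
Proof. exact: measurableT_comp. Qed.

Let mU k : measurable_fun setT (U k).
Proof. exact: measurable_sum. Qed.

Let partial_max_meas m : measurable_fun setT (partial_max m).
Proof. by elim: m => //= m IH; exact: measurable_maxr. Qed.

Let partial_max_ge m k w : (k <= m)%N -> U k w <= partial_max m w.
Proof.
elim: m => [|m IH] /=; first by rewrite leqn0 => /eqP ->.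
rewrite leq_eqVlt => /predU1P[->|]; rewrite le_max ?lexx ?orbT //.
by rewrite ltnS => /IH ->.
Qed.

Let partial_max_attained m w : exists k : 'I_m.+1, partial_max m w = U k w.
Proof.
elim: m => [|m [k IH]] /=; first by exists ord0.
rewrite /Num.max; case: ifP => _; first by exists ord_max.
by exists (widen_ord (leqnSn _) k).
Qed.

Let sup_sumE w : sup_sum Z F w = ereal_sup (range (fun k => (U k w)%:E)).
Proof.
congr ereal_sup; apply/seteqP; split => x /=.
  by move=> [_ [k _ <-] <-]; exists k.
by move=> [k _ <-]; exists (e k) => //; exists k.
Qed.

Let S_meas : measurable_fun setT (sup_sum Z F).
Proof.
rewrite (_ : sup_sum Z F = (fun w => ereal_sup (range (fun k => (U k w)%:E)))).
  by apply: measurable_ereal_sup_range => k; exact/measurable_EFinP.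
by apply/funext => w; rewrite sup_sumE.
Qed.

Let U_le_S k w : ((U k w)%:E <= sup_sum Z F w)%E.
Proof. by rewrite sup_sumE; apply: ereal_sup_ubound; exists k. Qed.

Let partial_max_le_S m w : ((partial_max m w)%:E <= sup_sum Z F w)%E.
Proof. by have [k ->] := partial_max_attained m w; exact: U_le_S. Qed.

Let B_meas : measurable_fun setT (max_sup_pow Z F p).
Proof.
have mi i : measurable_fun setT
    (fun w => ereal_sup [set (`|f (Z i w)| `^ p)%:E | f in F]).
  rewrite (_ : (fun w => _) =
      (fun w => ereal_sup (range (fun k => (`|e k (Z i w)| `^ p)%:E)))).
    apply: measurable_ereal_sup_range => k; apply/measurable_EFinP.
    by apply: (measurableT_comp (measurable_powR p)); exact: measurableT_comp.
  apply/funext => w; congr ereal_sup; apply/seteqP; split => x /=.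
    by move=> [_ [k _ <-] <-]; exists k.
  by move=> [k _ <-]; exists (e k) => //; exists k.
rewrite /max_sup_pow; elim: (index_enum _) => [|i s IH].
  by under eq_fun do rewrite big_nil; exact: measurable_cst.
by under eq_fun do rewrite big_cons; exact: measurable_maxe.
Qed.

Let B_ge0 w : (0 <= max_sup_pow Z F p w)%E.
Proof. exact: bigmax_ge_id. Qed.

Let B_ge k i w : ((`|e k (Z i w)| `^ p)%:E <= max_sup_pow Z F p w)%E.
Proof.
apply: le_trans (le_bigmax _ (fun i => ereal_sup [set (`|f (Z i w)| `^ p)%:E | f in F]) i).
by apply: ereal_sup_ubound; exists (e k) => //; exists k.
Qed.

(** Square integrability suffices, since the absolute value of [y] is at most [1 + y ^+ 2] and [P]
    is finite. *)
Let f_int k i : P.-integrable setT (fun w => (e k (Z i w))%:E).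
Proof.
have i2 : P.-integrable setT (fun w => (e k (Z i w) ^+ 2)%:E).
  apply/integrableP; split; first exact/measurable_EFinP/measurable_funX.
  have := f_sqr k i; rewrite expectation.unlock.
  rewrite (eq_integral (fun w => `|(e k (Z i w) ^+ 2)%:E|%E)) // => w _.
  by rewrite gee0_abs // lee_fin sqr_ge0.
have i1 := integrableD measurableT (finite_measure_integrable_cst P 1 measurableT) i2.
apply: le_integrable i1 => //; first exact/measurable_EFinP.
move=> w _; rewrite /= lee_fin.
set y := e k (Z i w); rewrite [leRHS]ger0_norm ?addr_ge0 ?sqr_ge0 //.
have := sqr_ge0 (`|y| - 2^-1); rewrite -[y ^+ 2]real_normK ?num_real // !expr2; lra.
Qed.

Let weak_var k : (\sum_i \int[P]_w (e k (Z i w) ^+ 2)%:E <= (D ^+ 2 / p)%:E)%E.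
Proof.
apply: le_trans f_var; apply: ereal_sup_ubound; exists (e k); first by exists k.
by apply: eq_bigr => i _; rewrite expectation.unlock.
Qed.

Let partial_max_moment m :
  (\int[P]_w (`|partial_max m w| `^ p)%:E <= ((72 * (c * expR 6) * D) `^ p)%:E)%E.
Proof.
apply: (@finite_class_moment _ _ _ _ _ P n Z indep 'I_m.+1 (fun j => e j) p c D
  p_ge1 c_ge D_gt0 _ _ _ (max_sup_pow Z F p)) => //.
- by move=> j i; have := f_mean j i; rewrite expectation.unlock.
- by move=> j w; apply: partial_max_ge; rewrite -ltnS.
- by move=> w; exact: partial_max_attained.
(* The positive part of a partial maximum is at most the absolute value of the supremum, whatever
   the sign of the latter. *)
apply: le_trans S_int; apply: ge0_le_integral => //.
- by move=> w _; rewrite lee_fin le_max lexx orbT.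
- by apply/measurable_EFinP; exact: measurable_maxr.
- exact: measurableT_comp.
- move=> w _; rewrite EFin_max ge_max abse_ge0 andbT.
  exact: le_trans (partial_max_le_S m w) (lee_abs _).
Qed.

Lemma countable_class_moment :
  (\int[P]_w (`|sup_sum Z F w| `^ p) <= ((72 * (c * expR 6) * D) `^ p)%:E)%E.
Proof.
apply: (@fatou_lsc _ _ _ P _ (fun m w => (`|partial_max m w| `^ p)%:E)).
- by apply: (measurableT_comp (measurable_poweR p)); exact: measurableT_comp.
- by move=> w; exact: poweR_ge0.
- move=> m; apply/measurable_EFinP.
  by apply: (measurableT_comp (measurable_powR p)); exact: measurableT_comp.
- by move=> m w; rewrite lee_fin powR_ge0.
- move=> w r.
  have near_ge (y : R) : (y%:E < sup_sum Z F w)%E ->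
      \forall m \near \oo, y <= partial_max m w.
    rewrite sup_sumE => /ereal_sup_gt[_ [k _ <-]]; rewrite lte_fin => yU.
    near=> m; apply: le_trans (ltW yU) (partial_max_ge _ _).
    by near: m; exact: nbhs_infty_ge.
  have := U_le_S 0%N w; have := partial_max_le_S.
  (* The value [-oo] is excluded, since the supremum is at least the first sum. *)
  case SE : (sup_sum Z F w) => [s| |] //= SM _.
    rewrite lte_fin => rS.
    apply: (near_powR_ge (u := fun m => `|partial_max m w|) p_gt0 _ _ rS) => //.
    apply: cvg_norm; apply/cvgrPdist_le => eps eps0.
    have := near_ge (s - eps); rewrite SE lte_fin gtrBl => /(_ eps0).
    apply: filterS => m h; rewrite ger0_norm ?subr_ge0; first by lra.
    by have := SM m w; rewrite SE lee_fin.
  (* Where the supremum is [+oo], the partial maxima eventually exceed both 1 and [r], and a number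
     above 1 is at most its power [p]. *)
  move=> _; have := near_ge (Num.max 1 r); rewrite SE ltry => /(_ isT).
  apply: filterS => m; rewrite ge_max => /andP[m1 mr].
  rewrite lee_fin (le_trans mr) // (le_trans (ler_norm _)) //.
  by apply: le1r_powR => //; apply: le_trans m1 (ler_norm _).
- by apply: nearW => m; exact: partial_max_moment.
Unshelve. all: by end_near. Qed.

End CountableClass.

Local Open Scope ereal_scope.

(** * The general inequality in terms of a single scale *)

Lemma powR_le_inv (R : realType) (a b p : R) : (0 < p)%R -> (0 <= a)%R ->
  (0 <= b)%R -> (a `^ p <= b `^ p)%R -> (a <= b)%R.
Proof.
move=> p0 a0 b0; rewrite leNgt => ab; rewrite leNgt; apply: contra ab => ba.
by apply: gt0_ltr_powR; rewrite ?nnegrE.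
Qed.

Lemma fin_num_scale (R : realType) (r : R) (x : \bar R) : (0 < r)%R -> 0 <= x ->
  r%:E * x \is a fin_num -> x \is a fin_num.
Proof. by move=> r0; case: x => // _; rewrite gt0_muley ?lte_fin. Qed.

Unset Implicit Arguments.

Theorem proposition3p1 (R : realType) :
  exists K : R, (0 < K)%R /\
  forall (d d' : measure_display) (Omega : measurableType d)
    (T : measurableType d') (P : probability Omega R)
    (n : nat) (Z : 'I_n -> {RV P >-> T}) (F : set {mfun T >-> R}),
    mutually_independent Z ->
    countable F ->
    (forall (f : {mfun T >-> R}) (i : 'I_n), F f ->
       'E_P[(fun w => (f (Z i w) ^+ 2)%R)] < +oo) ->
    (forall (f : {mfun T >-> R}) (i : 'I_n), F f ->
       'E_P[(fun w => f (Z i w))] = 0) ->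
  let S := sup_sum Z F in
  let sigma := sqrte (weak_variance Z F) in
  forall p : R, (1 <= p)%R ->
    \int[P]_w (`|S w| `^ p) <=
    (K `^ p)%R%:E *
      ((\int[P]_w `|S w|) `^ p
       + (p `^ (p / 2))%R%:E * sigma `^ p
       + (p `^ p)%R%:E * \int[P]_w max_sup_pow Z F p w).
Proof.
(* The constant of [countable_class_moment] at [c = 3552]. *)
exists (72 * (3552 * expR 6))%R.
set K := (72 * _)%R.
have K_gt0 : (0 < K)%R by rewrite !mulr_gt0 ?ltr0n ?expR_gt0.
split; first exact: K_gt0.
move=> d d' Omega T P n Z F indep cF f_sqr f_mean S sigma p p_ge1.
have p_gt0 : (0 < p)%R by exact: lt_le_trans p_ge1.
have pN0 : p != 0%R by rewrite gt_eqF.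
set A := \int[P]_w `|S w|; set Bi := \int[P]_w max_sup_pow Z F p w.
have A_ge0 : 0 <= A by apply: integral_ge0.
have Bi_ge0 : 0 <= Bi by apply: integral_ge0 => w _; exact: bigmax_ge_id.
have Kp_gt0 : (0 < K `^ p)%R by exact: powR_gt0.
set s2 := _ * sigma `^ p; set s3 := _ * Bi.
have s2_ge0 : 0 <= s2 by rewrite mule_ge0 ?lee_fin ?powR_ge0 ?poweR_ge0.
have s3_ge0 : 0 <= s3 by rewrite mule_ge0 ?lee_fin ?powR_ge0.
have s1_ge0 : 0 <= A `^ p by exact: poweR_ge0.
(* If the right-hand side is infinite, the inequality is trivial; otherwise all its terms are
   finite. *)
have [fin|] := boolP (A `^ p + s2 + s3 \is a fin_num); last first.
  rewrite ge0_fin_numE ?adde_ge0 // -leNgt leye_eq => /eqP ->.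
  by rewrite gt0_muley ?lte_fin // leey.
move: (fin); rewrite !fin_numD => /andP[/andP[A_fin s2_fin] s3_fin].
have A_lty : A < +oo.
  by apply: (lty_poweRy pN0); rewrite -ge0_fin_numE.
(* For the empty class [S] is [-oo], which would make [A] infinite. *)
have F0 : F !=set0.
  apply/set0P/eqP => F0; move: A_lty.
  have SE w : `|S w| = +oo.
    by rewrite /S /sup_sum F0 image_set0 ereal_sup0.
  rewrite /A (eq_integral (cst +oo)) => [|w _]; last by rewrite SE.
  rewrite integral_cst // [X in +oo * X](_ : _ = 1); last exact: probability_setT.
  by rewrite mule1.
have [e FE] := countable_enumeration cF F0; subst F.
have W_ge0 : 0 <= weak_variance Z (range e).
  apply: (@le_trans _ _ (\sum_(i < n) 'E_P[(fun w => (e 0%N (Z i w) ^+ 2)%R)])).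
    apply: sume_ge0 => i _; rewrite expectation.unlock.
    by apply: integral_ge0 => w _; rewrite lee_fin sqr_ge0.
  by apply: ereal_sup_ubound; exists (e 0%N) => //; exists 0%N.
have sp_gt0 : (0 < p `^ (p / 2))%R by exact: powR_gt0.
have pp_gt0 : (0 < p `^ p)%R by exact: powR_gt0.
have sigma_fin : sigma \is a fin_num.
  rewrite ge0_fin_numE ?sqrte_ge0 //; apply: (lty_poweRy pN0).
  by rewrite -ge0_fin_numE ?poweR_ge0 // (fin_num_scale sp_gt0) // poweR_ge0.
have Bi_fin : Bi \is a fin_num by apply: (fin_num_scale pp_gt0).
have W_fin : weak_variance Z (range e) \is a fin_num by rewrite -sqrte_fin_num.
set a := fine A; set s := fine sigma; set b := fine Bi.
have A_finE : A = a%:E by rewrite fineK // ge0_fin_numE.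
have sigmaE : sigma = s%:E by rewrite fineK.
have BiE : Bi = b%:E by rewrite fineK.
have a0 : (0 <= a)%R by exact: fine_ge0.
have s0 : (0 <= s)%R by apply: fine_ge0; exact: sqrte_ge0.
have b0 : (0 <= b)%R by exact: fine_ge0.
have WE : weak_variance Z (range e) = (s ^+ 2)%:E.
  by rewrite -(sqr_sqrte W_ge0) -/sigma sigmaE.
have sE : (p `^ (p / 2) * s `^ p = (Num.sqrt p * s) `^ p)%R.
  by rewrite powRM ?sqrtr_ge0 // -powR12_sqrt ?(ltW p_gt0) // -powRrM [(p / 2)%R]mulrC.
rewrite /s2 /s3 A_finE sigmaE BiE !poweR_EFin -!EFinM sE.
set X := (_ + _ + _)%R.
(* The scale [D] must be positive whereas [X] may vanish, hence a margin; it is chosen such that the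
   power [p] of [K * D] exceeds the desired bound by exactly [eps]. *)
apply/lee_addgt0Pr => eps eps0.
have X0 : (0 <= X)%R by rewrite !addr_ge0 ?mulr_ge0 ?powR_ge0.
have epsK : (0 < eps / K `^ p)%R by rewrite divr_gt0.
pose D := ((X + eps / K `^ p) `^ p^-1)%R.
have DX : (D `^ p = X + eps / K `^ p)%R.
  by rewrite -powRrM mulVf // powRr1 // addr_ge0 // ltW.
have D_gt0 : (0 < D)%R by rewrite powR_gt0 // ltr_wpDl.
have t1 : (0 <= a `^ p)%R by exact: powR_ge0.
have t2 : (0 <= (Num.sqrt p * s) `^ p)%R by exact: powR_ge0.
have t3 : (0 <= p `^ p * b)%R by rewrite mulr_ge0 ?powR_ge0.
have KD : ((K * D) `^ p = K `^ p * X + eps)%R.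
  rewrite powRM ?(ltW K_gt0) ?(ltW D_gt0) // DX mulrDr; congr (_ + _)%R.
  by rewrite mulrC divfK // gt_eqF.
rewrite -EFinD -KD.
have le_D y : (0 <= y)%R -> (y `^ p <= X)%R -> (y <= D)%R.
  move=> y0 yX; apply: (powR_le_inv p_gt0 y0 (ltW D_gt0)).
  by rewrite DX (le_trans yX) // lerDl ltW.
(* Each of the three terms of [X] is at most the power [p] of [D]; this gives the bounds on the
   mean, the weak variance and the maximum. *)
apply: countable_class_moment => //.
- by move=> k i; apply: f_sqr; exists k.
- by move=> k i; apply: f_mean; exists k.
- by rewrite -/S -/A A_finE lee_fin le_D // /X -addrA lerDl addr_ge0.
- rewrite WE lee_fin ler_pdivlMr // mulrC.
  have : (Num.sqrt p * s <= D)%R.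
    apply: le_D; first by rewrite mulr_ge0 ?sqrtr_ge0.
    by rewrite /X addrAC lerDr addr_ge0.
  rewrite -ler_sqr ?nnegrE ?mulr_ge0 ?sqrtr_ge0 ?(ltW D_gt0) //.
  by rewrite exprMn sqr_sqrtr // ltW.
- rewrite -/Bi BiE lee_fin powRM ?invr_ge0 ?(ltW D_gt0) ?(ltW p_gt0) //.
  rewrite -[(p^-1)%R]powR_inv1 ?(ltW p_gt0) // powRAC powR_inv1 ?powR_ge0 //.
  rewrite ler_pdivlMr // mulrC DX (@le_trans _ _ X) // ?lerDl ?(ltW epsK) //.
  by rewrite /X lerDr addr_ge0.
Qed.
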